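(* Let $0<\alpha<1$ and let $X$ be a non-negative random variable with CDF $F$ and $E(|X|^p)<\infty$ for some $p>1$. Let $\tilde F_n$ be the empirical CDF of a random sample $(X_1,\dots,X_n)$ drawn from $F$. Then $$\mathcal{E}^*_\alpha(\tilde F_n)\longrightarrow \mathcal{E}^*_\alpha(F)\quad\text{almost surely as } n\to\infty.$$
   Context: For $0<\alpha<1$, $E_\alpha(x)=\sum_{k\ge 0} x^k/\Gamma(\alpha k+1)$ is the Mittag-Leffler function and $Ln_\alpha$ denotes its inverse; $Ln_\alpha 1=0$, $Ln_\alpha 0=-\infty$, $Ln_\alpha x<0$ for $x<1$, and the convention $0\cdot[-Ln_\alpha 0]^{1/\alpha}=0$ is used. For a CDF $G$ of a non-negative random variable, $\mathcal{E}^*_\alpha(G)=\int_0^\infty G(x)[-Ln_\alpha G(x)]^{1/\alpha}\,dx$ (the EFCPE). Standing assumption of the paper: random variables are non-negative and absolutely continuous. With order statistics $X_{1:n}\le\dots\le X_{n:n}$ of the sample, the empirical CDF is $\tilde F_n(x)=0$ for $x<X_{1:n}$, $\tilde F_n(x)=k/n$ for $X_{k:n}\le x<X_{k+1:n}$ ($k=1,\dots,n-1$), and $\tilde F_n(x)=1$ for $x\ge X_{n:n}$. *)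

(* Defs.v *)
From HB Require Import structures.
From mathcomp Require Import all_boot all_order all_algebra.
From mathcomp Require Import finmap.
From mathcomp Require Import all_classical all_reals all_analysis.

Set Implicit Arguments.
Unset Strict Implicit.
Unset Printing Implicit Defensive.

Import Order.TTheory GRing.Theory Num.Theory.
Import numFieldNormedType.Exports.

Local Open Scope classical_set_scope.
Local Open Scope ring_scope.

Section mittag_leffler.
Context {R : realType}.

(* Meaningful for 0 < z; otherwise the integral diverges and [Rintegral]
   returns a junk value. Only the values at z >= 1 are used below. *)
Definition Gamma (z : R) : R :=
  \int[lebesgue_measure]_(t in `]0, +oo[) (t `^ (z - 1) * expR (- t)).

Definition MittagLeffler (alpha x : R) : R :=
  limn (series (fun k : nat => x ^+ k / Gamma (alpha * k%:R + 1))).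

(* For 0 < alpha < 1, [MittagLeffler alpha] is a bijection from R onto the
   positive reals, so [pinv] is the genuine inverse at every y > 0; the value
   at y < 0 is junk. *)
Definition Ln (alpha y : R) : \bar R :=
  if y == 0 then -oo%E
  else (pinv [set: R] (MittagLeffler alpha) y)%:E.

(* Where G x = 0 the integrand is 0 * (+oo) `^ alpha^-1, which is 0 by the
   convention of [mule]. *)
Definition efcpe (alpha : R) (G : R -> R) : \bar R :=
  (\int[lebesgue_measure]_(x in `[0%R, +oo[)
     ((G x)%:E * (- Ln alpha (G x)) `^ (alpha^-1)%R))%E.

End mittag_leffler.

Section empirical_cdf.
Context {R : realType}.

(* k-th smallest element of s, for 1 <= k <= size s. *)
Definition order_stat (s : seq R) (k : nat) : R := nth 0 (sort <=%R s) k.-1.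

(* At most one k satisfies the condition under the sum. *)
Definition empirical_cdf (s : seq R) (x : R) : R :=
  let n := size s in
  if x < order_stat s 1 then 0
  else if order_stat s n <= x then 1
  else \sum_(1 <= k < n | order_stat s k <= x < order_stat s k.+1) k%:R / n%:R.

End empirical_cdf.

Section random_sample.
Context d (T : measurableType d) (R : realType) (P : probability T R).

Definition mutually_independent (X : nat -> {RV P >-> R}) : Prop :=
  forall (J : {fset nat}) (A : nat -> set R),
    (forall i, measurable (A i)) ->
    P (\bigcap_(i in [set` J]) X i @^-1` A i)
      = (\prod_(i <- J) P (X i @^-1` A i))%E.

(* The first n members of the sequence X form a random sample of size n. *)
Definition random_sample_from (F : R -> \bar R) (X : nat -> {RV P >-> R}) :=
  mutually_independent X /\ forall i, cdf (X i) =1 F.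

End random_sample.

(* Main.v *)
Require Import Defs.
From HB Require Import structures.
From mathcomp Require Import all_boot all_order all_algebra.
From mathcomp Require Import finmap ring lra zify.
From mathcomp Require Import all_classical all_reals all_analysis.
From mathcomp Require Import measurable_realfun.
Set Implicit Arguments.
Unset Strict Implicit.
Unset Printing Implicit Defensive.
Import Order.TTheory GRing.Theory Num.Theory.
Import numFieldNormedType.Exports.
Local Open Scope classical_set_scope.
Local Open Scope ring_scope.

(** Write [h u = u (- Ln u) ^ (1 / alpha)], so that the efcpe of [G] is the integral of
    [h (G x)] over [x >= 0]. By the law of large numbers [F_n x] tends to [F x], and [h] is
    continuous on [(0, 1]], so everything lies in passing to the limit under the integral.
    This is delicate because [h] is unbounded: it behaves like [u ^ (1 - 1 / alpha)] at [0]
    and like [(1 - u) ^ (1 / alpha)] at [1].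

    These two-sided bounds ([efcpe_kernel_upper], [efcpe_kernel_lower]) rest on the behaviour
    of the Mittag-Leffler function [E] on the negative half-line: it is positive, strictly
    decreasing, and [E (- x)] lies between two functions of the form [1 / (1 + c x)].
    They are obtained by discretisation. The coefficients of
    [(1 - z)^(alpha - 1) / ((1 - z)^alpha + l)] are nonnegative and nonincreasing, because
    [1 - (1 - z)^alpha] has nonnegative coefficients, and simple identities between such
    power series bound them and their differences in [l] ([relax_upper], [relax_lower],
    [relax_diff_lower]). With [l = x / n ^ alpha] the [n]-th coefficient tends to [E (- x)]
    ([relax_cvg_ML]), by Euler's limit formula for Gamma ([rbinom_cvg]).

    If the efcpe of [F] is infinite, Fatou's lemma concludes. Otherwise convergence is
    dominated along almost every sample path. With [g = 1 / alpha - 1] and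
    [r = min (1 / alpha, 2) > 1] there are random majorants of [F_n x ^ (- g)] and
    [(1 - F_n x) ^ r], valid for all [n] at once, whose means are at most [C F x ^ (- g)] and
    [C (1 - F x)]: monotonicity of the counts reduces the supremum to dyadic [n], where
    Chernoff's bound ([inv_majorant_expectation]) and the variance
    ([tail_majorant_expectation]) make the series converge. The first mean is integrable on
    bounded intervals because [h (F x)] is integrable, the second on the half-line because
    the moment assumption makes the mean of [X] finite; by Tonelli almost every path of the
    majorants is integrable. Beyond a point where [F >= 1/2] the empirical distribution
    function is eventually at least [1/4], so that only its upper tail matters there. *)

(** * Formal power series *)

Section formal_power_series.
Context {R : comNzRingType}.

Definition fps := nat -> R.

HB.instance Definition _ := GRing.Zmodule.on fps.

Lemma fpsD (a b : fps) (n : nat) : (a + b) n = a n + b n.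
Proof. by []. Qed.

Lemma fpsN (a : fps) (n : nat) : (- a) n = - a n.
Proof. by []. Qed.

Definition fps_trunc (n : nat) (a : fps) : {poly R} := \poly_(i < n) a i.

Definition fps_mul (a b : fps) : fps := fun n => \sum_(i < n.+1) a i * b (n - i)%N.

Definition fps_one : fps := fun n => (n == 0%N)%:R.

(** Below degree [N] the Cauchy product is the product of truncations, so the
    ring axioms can be read off polynomials. *)
Lemma fps_mul_trunc (N n : nat) (a b : fps) : (n < N)%N ->
  fps_mul a b n = (fps_trunc N a * fps_trunc N b)`_n.
Proof.
move=> nN; rewrite coefM; apply: eq_bigr => i _.
have iN : (i < N)%N by apply: leq_ltn_trans nN; rewrite -ltnS.
by rewrite !coef_poly iN (leq_ltn_trans _ nN) ?leq_subr.
Qed.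

Lemma fps_trunc_mul (N n : nat) (a b : fps) : (n < N)%N ->
  (fps_trunc N (fps_mul a b))`_n = (fps_trunc N a * fps_trunc N b)`_n.
Proof. by move=> nN; rewrite coef_poly nN; exact: fps_mul_trunc. Qed.

Lemma fps_mulA : associative fps_mul.
Proof.
move=> a b c; apply/funext => n.
rewrite !(@fps_mul_trunc n.+1)//.
transitivity ((fps_trunc n.+1 a * (fps_trunc n.+1 b * fps_trunc n.+1 c))`_n).
  rewrite [LHS]coefM [RHS]coefM; apply: eq_bigr => i _; congr (_ * _).
  by rewrite fps_trunc_mul// ltnS leq_subr.
rewrite mulrA [LHS]coefM [RHS]coefM; apply: eq_bigr => i _; congr (_ * _).
by rewrite fps_trunc_mul.
Qed.

Lemma fps_mulC : commutative fps_mul.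
Proof. by move=> a b; apply/funext => n; rewrite !(@fps_mul_trunc n.+1)// mulrC. Qed.

Lemma fps_mul1 : left_id fps_one fps_mul.
Proof.
move=> a; apply/funext => n; rewrite /fps_mul big_ord_recl /= subn0 mul1r.
by rewrite big1 ?addr0// => i _; rewrite /fps_one /= mul0r.
Qed.

Lemma fps_mulDl : left_distributive fps_mul +%R.
Proof.
move=> a b c; apply/funext => n; rewrite fpsD /fps_mul -big_split /=.
by apply: eq_bigr => i _; rewrite mulrDl.
Qed.

Lemma fps_one_neq0 : fps_one != 0.
Proof.
apply/eqP => /(congr1 (fun f : fps => f 0%N)) /eqP.
by rewrite /fps_one eqxx oner_eq0.
Qed.

HB.instance Definition _ := GRing.Zmodule_isComNzRing.Build fps
  fps_mulA fps_mulC fps_mul1 fps_mulDl fps_one_neq0.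

Lemma fpsM (a b : fps) (n : nat) :
  (a * b) n = \sum_(i < n.+1) a i * b (n - i)%N.
Proof. by []. Qed.

Lemma fps1E (n : nat) : (1 : fps) n = (n == 0%N)%:R.
Proof. by []. Qed.

Definition fpsC (c : R) : fps := fun n => if n is 0%N then c else 0.

Lemma fpsCM (c : R) (a : fps) (n : nat) : (fpsC c * a) n = c * a n.
Proof.
rewrite fpsM big_ord_recl/= subn0 big1 ?addr0// => i _.
by rewrite /fpsC /= mul0r.
Qed.

End formal_power_series.
Arguments fps : clear implicits.

(** * Powers of 1 - z *)

Section binomial_series.
Context {R : realFieldType}.
Implicit Types (b c : R) (n : nat).

(** Coefficient of [z^n] in [(1 - z)^(-b)]. *)
Definition rbinom b : fps R := fun n => \prod_(j < n) ((b + j%:R) / j.+1%:R).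

Lemma rbinom0 b : rbinom b 0 = 1.
Proof. by rewrite /rbinom big_ord0. Qed.

Lemma rbinomS b n : rbinom b n.+1 = rbinom b n * ((b + n%:R) / n.+1%:R).
Proof. by rewrite /rbinom big_ord_recr. Qed.

Lemma rbinomSM b n : n.+1%:R * rbinom b n.+1 = (b + n%:R) * rbinom b n.
Proof.
by rewrite rbinomS mulrCA [RHS]mulrC mulrC [n.+1%:R * _]mulrC divfK ?pnatr_eq0// mulrC.
Qed.

Lemma rbinom_shift b n : b * rbinom (b + 1) n = (b + n%:R) * rbinom b n.
Proof.
elim: n => [|n IH]; first by rewrite !rbinom0 addr0.
rewrite rbinomS mulrA IH rbinomS -natr1; ring.
Qed.

(** Vandermonde's identity, by comparing the logarithmic derivatives of the two
    sides. *)
Lemma rbinomD b c : rbinom (b + c) = rbinom b * rbinom c.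
Proof.
apply/funext => n; elim: n => [|n IH].
  by rewrite fpsM big_ord_recl big_ord0 !rbinom0 addr0 mulr1.
have n0 : (n.+1%:R : R) != 0 by rewrite pnatr_eq0.
apply: (mulfI n0); rewrite rbinomSM IH !fpsM [LHS]mulr_sumr [RHS]mulr_sumr.
under [RHS]eq_bigr => i _.
  have -> : n.+1%:R * (rbinom b i * rbinom c (n.+1 - i)%N) =
      i%:R * rbinom b i * rbinom c (n.+1 - i)%N +
      rbinom b i * ((n.+1 - i)%N%:R * rbinom c (n.+1 - i)%N).
    by rewrite natrB -1?ltnS//; ring.
  over.
rewrite big_split/= [X in _ = X + _]big_ord_recl/= !mul0r add0r.
rewrite [X in _ = _ + X]big_ord_recr/= subnn !mul0r mulr0 addr0 -big_split/=.
apply: eq_bigr => i _; rewrite subSS rbinomSM.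
have iln : (i <= n)%N by rewrite -ltnS.
rewrite (subSn iln) rbinomSM natrB//; ring.
Qed.

Lemma rbinom_zero : rbinom 0 = 1.
Proof.
apply/funext => -[|n]; first by rewrite rbinom0.
by rewrite /rbinom big_ord_recl/= add0r !mul0r.
Qed.

Lemma rbinom_one n : rbinom 1 n = 1.
Proof.
by rewrite /rbinom big1// => i _; rewrite -[1 + _]mulrS divff// pnatr_eq0.
Qed.

Lemma fps_sumE (a : fps R) n : (rbinom 1 * a) n = \sum_(i < n.+1) a i.
Proof.
rewrite mulrC fpsM; apply: eq_bigr => i _.
by rewrite rbinom_one mulr1.
Qed.

Lemma rbinom_ge0 b n : 0 <= b -> 0 <= rbinom b n.
Proof. by move=> b0; apply: prodr_ge0 => i _; rewrite divr_ge0 ?addr_ge0. Qed.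

Lemma rbinom_gt0 b n : 0 < b -> 0 < rbinom b n.
Proof. by move=> b0; apply: prodr_gt0 => i _; rewrite divr_gt0 ?ltr_pwDl. Qed.

Lemma rbinom_le b c n : 0 <= b -> b <= c -> rbinom b n <= rbinom c n.
Proof.
move=> b0 bc; apply: ler_prod => i _.
by rewrite divr_ge0 ?addr_ge0//= ler_pM2r ?invr_gt0 ?ltr0n// lerD2r.
Qed.

Lemma rbinomDS b n : rbinom (b + 1) n.+1 = rbinom b n.+1 + rbinom (b + 1) n.
Proof. by rewrite addrC rbinomD !fps_sumE [LHS]big_ord_recr/= addrC. Qed.

Lemma rbinom_nat_le (k n : nat) : rbinom (k%:R + 1) n <= 2 ^+ (n + k).
Proof.
elim: k n => [|k IH] n.
  rewrite add0r rbinom_one addn0; apply: exprn_ege1; exact: ler1n.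
elim: n => [|n IHn]; first by rewrite rbinom0; apply: exprn_ege1; exact: ler1n.
rewrite rbinomDS -[k.+1%:R]natr1.
apply: le_trans (lerD (IH n.+1) _) _; first by rewrite natr1; exact: IHn.
by rewrite !addnS !addSn (exprS _ (n + k).+1) mulr_natl mulr2n.
Qed.

Lemma rbinom_le1_nonincr b n : 0 <= b <= 1 -> rbinom b n.+1 <= rbinom b n.
Proof.
move=> /andP[b0 b1]; rewrite rbinomS ler_piMr ?rbinom_ge0//.
by rewrite ler_pdivrMr ?ltr0n// mul1r -natr1 addrC lerD2l.
Qed.

End binomial_series.

(** * The discrete relaxation sequence *)

Section discrete_relaxation.
Context {R : realFieldType} (alpha : R) (alpha01 : 0 < alpha < 1).
Implicit Types (l m : R) (n j : nat).

(** [1 - (1 - z)^alpha], whose coefficients are the Sibuya probabilities. *)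
Definition sibuya : fps R := 1 - rbinom (- alpha).

Lemma sibuya0 : sibuya 0 = 0.
Proof. by rewrite /sibuya fpsD fpsN fps1E rbinom0 subrr. Qed.

Lemma sibuya_ge0 n : 0 <= sibuya n.
Proof.
case/andP: alpha01 => a0 a1; case: n => [|n]; first by rewrite sibuya0.
rewrite /sibuya fpsD fpsN fps1E/= add0r /rbinom big_ord_recl/= addr0 divr1.
rewrite mulNr opprK mulr_ge0 ?(ltW a0)//; apply: prodr_ge0 => i _.
rewrite divr_ge0// addrC subr_ge0 (le_trans (ltW a1))//.
by rewrite /bump leq0n add1n ler1n.
Qed.

Lemma sibuyaX_ge0 j n : 0 <= (sibuya ^+ j) n.
Proof.
elim: j n => [|j IH] n; first by rewrite expr0 fps1E.
by rewrite exprS fpsM sumr_ge0// => i _; rewrite mulr_ge0// sibuya_ge0.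
Qed.

Lemma sibuyaX_lt j n : (n < j)%N -> (sibuya ^+ j) n = 0.
Proof.
elim: j n => [|j IH] n // nj; rewrite exprS fpsM big1// => -[[|i] ilt] _ /=.
  by rewrite sibuya0 mul0r.
by rewrite IH ?mulr0//; lia.
Qed.

(** Coefficients of [1 / ((1 - z)^alpha + l)], as the geometric series in
    [sibuya]; this form makes their positivity evident. *)
Definition resolvent l : fps R := fun n =>
  \sum_(j < n.+1) (1 + l)^-1 ^+ j.+1 * (sibuya ^+ j) n.

Lemma resolvent_ge0 l n : 0 <= l -> 0 <= resolvent l n.
Proof.
move=> l0; apply: sumr_ge0 => j _; rewrite mulr_ge0 ?sibuyaX_ge0//.
by rewrite exprn_ge0// invr_ge0 addr_ge0.
Qed.

Lemma fps_sum_coef (I : Type) (r : seq I) (f : I -> fps R) n :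
  (\sum_(i <- r) f i) n = \sum_(i <- r) f i n.
Proof. by elim/big_rec2: _ => //= i y1 y2 _ <-; rewrite fpsD. Qed.

Lemma resolventE l : 0 <= l ->
  resolvent l * (rbinom (- alpha) + fpsC l) = 1.
Proof.
move=> l0; have l1 : 1 + l != 0 by rewrite gt_eqF// ltr_pwDl.
apply/funext => n; set c := (1 + l)^-1.
pose S : fps R := \sum_(j < n.+1) fpsC (c ^+ j.+1) * sibuya ^+ j.
have SE i : (i <= n)%N -> resolvent l i = S i.
  move=> ile; rewrite /S fps_sum_coef /resolvent.
  under [RHS]eq_bigr do rewrite fpsCM.
  rewrite -(big_mkord xpredT (fun j => c ^+ j.+1 * (sibuya ^+ j) i)).
  rewrite -(big_mkord xpredT (fun j => c ^+ j.+1 * (sibuya ^+ j) i)).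
  rewrite [RHS](big_cat_nat (n := i.+1))//= [X in _ = _ + X]big1_seq ?addr0//.
  move=> j /andP[_]; rewrite mem_index_iota => /andP[ij _].
  by rewrite sibuyaX_lt// mulr0.
have -> : (resolvent l * (rbinom (- alpha) + fpsC l)) n =
    (S * (rbinom (- alpha) + fpsC l)) n.
  by rewrite !fpsM; apply: eq_bigr => i _; rewrite SE// -ltnS.
have fpsCD (a b : R) : fpsC (a + b) = fpsC a + fpsC b.
  by apply/funext => -[|k]; rewrite fpsD//= addr0.
have fpsC1 : fpsC 1 = 1 :> fps R by apply/funext => -[|k].
have fpsCMM (a b : R) : fpsC (a * b) = fpsC a * fpsC b.
  by apply/funext => -[|k]; rewrite fpsCM//= mulr0.
have -> : rbinom (- alpha) + fpsC l = fpsC (1 + l) - sibuya.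
  rewrite /sibuya fpsCD fpsC1; ring.
have -> : S * (fpsC (1 + l) - sibuya) = 1 - fpsC (c ^+ n.+1) * sibuya ^+ n.+1.
  have H k : (\sum_(j < k) fpsC (c ^+ j.+1) * sibuya ^+ j) *
      (fpsC (1 + l) - sibuya) = 1 - fpsC (c ^+ k) * sibuya ^+ k.
    elim: k => [|k IH]; first by rewrite big_ord0 mul0r !expr0 fpsC1 mul1r subrr.
    rewrite big_ord_recr/= mulrDl IH.
    have -> : fpsC (c ^+ k) = fpsC (c ^+ k.+1) * fpsC (1 + l).
      by rewrite -fpsCMM exprS mulrAC mulVf// mul1r.
    by rewrite (exprS sibuya); ring.
  exact: H.
by rewrite fpsD fpsN fpsCM sibuyaX_lt// mulr0 subr0.
Qed.

(** Coefficients of [(1 - z)^(alpha - 1) / ((1 - z)^alpha + l)]. This is the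
    solution of the relaxation equation for the fractional difference of order
    [alpha]; with [l = x / n ^ alpha] its [n]-th term tends to the
    Mittag-Leffler function at [- x]. *)
Definition relax l : fps R := rbinom (1 - alpha) * resolvent l.

Lemma fps_ge0M (a b : fps R) n : (forall i, 0 <= a i) -> (forall i, 0 <= b i) ->
  0 <= (a * b) n.
Proof. by move=> a0 b0; rewrite fpsM sumr_ge0// => i _; rewrite mulr_ge0. Qed.

Lemma relax_ge0 l n : 0 <= l -> 0 <= relax l n.
Proof.
case/andP: alpha01 => a0 a1 l0; apply: fps_ge0M => i; last exact: resolvent_ge0.
by apply: rbinom_ge0; rewrite subr_ge0 ltW.
Qed.

Lemma relax_sum l n : 0 <= l ->
  relax l n = 1 - l * \sum_(j < n.+1) resolvent l j.
Proof.
move=> l0; have H : relax l + fpsC l * (rbinom 1 * resolvent l) = rbinom 1.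
  rewrite /relax rbinomD -[RHS]mulr1 -(resolventE l0); ring.
have /(congr1 (fun f : fps R => f n)) := H.
by rewrite fpsD fpsCM rbinom_one fps_sumE => <-; rewrite addrK.
Qed.

Lemma relax_renewal l : 0 <= l ->
  relax l + fpsC l * (rbinom alpha * relax l) = rbinom 1.
Proof.
move=> l0; have -> : rbinom 1 = rbinom alpha * rbinom (1 - alpha) :> fps R.
  by rewrite -rbinomD; congr rbinom; ring.
have e : rbinom alpha * rbinom (- alpha) = 1 :> fps R.
  by rewrite -rbinomD subrr rbinom_zero.
rewrite /relax -{1}[rbinom (1 - alpha)]mulr1 -e.
transitivity (rbinom alpha * rbinom (1 - alpha) *
  (resolvent l * (rbinom (- alpha) + fpsC l))); first by ring.
by rewrite resolventE// mulr1.
Qed.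

Lemma relax_nonincr l i j : 0 <= l -> (i <= j)%N -> relax l j <= relax l i.
Proof.
move=> l0; elim: j => [|j IH]; first by rewrite leqn0 => /eqP ->.
rewrite leq_eqVlt => /predU1P[->//|ij]; apply: le_trans (IH ij).
rewrite !relax_sum// lerD2l lerN2 ler_wpM2l// [leRHS]big_ord_recr/= lerDl.
exact: resolvent_ge0.
Qed.

Lemma relax_le1 l n : 0 <= l -> relax l n <= 1.
Proof.
move=> l0; rewrite relax_sum// gerBl mulr_ge0//.
by apply: sumr_ge0 => i _; exact: resolvent_ge0.
Qed.

Lemma relaxE l n : 0 <= l ->
  relax l n + l * \sum_(i < n.+1) rbinom alpha i * relax l (n - i)%N = 1.
Proof.
by move=> l0; rewrite -(rbinom_one n) -(relax_renewal l0) fpsD fpsCM fpsM.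
Qed.

Lemma sum_rbinom n : \sum_(i < n.+1) rbinom alpha i = rbinom (alpha + 1) n.
Proof. by rewrite addrC rbinomD fps_sumE. Qed.

(** The renewal equation reads [F = 1 / (1 - z) - l (1 - z)^(-alpha) F]; by monotonicity
    the last term [f_n] bounds from below every [f_i] in the convolution. *)
Lemma relax_upper l n : 0 <= l -> relax l n * (1 + l * rbinom (alpha + 1) n) <= 1.
Proof.
case/andP: alpha01 => a0 a1.
move=> l0; rewrite -[leRHS](relaxE n l0) mulrDr mulr1 lerD2l mulrCA.
rewrite ler_wpM2l// -sum_rbinom mulr_sumr; apply: ler_sum => i _.
by rewrite mulrC ler_wpM2l ?rbinom_ge0 ?(ltW a0)// relax_nonincr// leq_subr.
Qed.

Lemma relax_lower1 l n : 0 <= l -> 1 - relax l n <= l * rbinom (alpha + 1) n.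
Proof.
case/andP: alpha01 => a0 a1.
move=> l0; rewrite -[X in X - _](relaxE n l0) addrAC subrr add0r.
rewrite ler_wpM2l// -sum_rbinom; apply: ler_sum => i _.
by rewrite ler_piMr ?rbinom_ge0 ?(ltW a0)// relax_le1.
Qed.

Lemma rbinom_nonincr b i j : 0 <= b <= 1 -> (i <= j)%N ->
  rbinom b j <= rbinom b i :> R.
Proof.
move=> b01; elim: j => [|j IH]; first by rewrite leqn0 => /eqP ->.
rewrite leq_eqVlt => /predU1P[->//|ij]; apply: le_trans (IH ij).
exact: rbinom_le1_nonincr.
Qed.

(** [f_n] is the convolution of [rbinom (1 - alpha)] with the resolvent; the former
    decreases, and the partial sums of the latter are [(1 - f_n) / l]. *)
Lemma relax_lower l n : 0 <= l ->
  rbinom (1 - alpha) n * (1 - relax l n) <= l * relax l n.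
Proof.
case/andP: alpha01 => a0 a1.
move=> l0; rewrite {1}relax_sum// subKr mulrCA ler_wpM2l// mulr_sumr.
rewrite /relax mulrC fpsM; apply: ler_sum => -[i ilt] _ /=; rewrite mulrC.
rewrite ler_wpM2l ?resolvent_ge0// rbinom_nonincr ?leq_subr//.
by rewrite subr_ge0 gerBl !ltW.
Qed.

(** Resolvent identity: [F_l - F_m = (m - l) F_l K_m], all of positive terms. *)
Lemma relax_diff l m n : 0 <= l -> 0 <= m ->
  relax l n - relax m n = (m - l) * (relax l * resolvent m) n.
Proof.
move=> l0 m0.
suff H : relax l - relax m = fpsC (m - l) * (relax l * resolvent m) :> fps R.
  have /(congr1 (fun f : fps R => f n)) := H.
  by rewrite fpsD fpsN fpsCM.
have -> : fpsC (m - l) = fpsC m - fpsC l :> fps R.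
  by apply/funext => -[|k]; rewrite fpsD fpsN//= subr0.
rewrite /relax.
transitivity (rbinom (1 - alpha) *
  (resolvent l * (resolvent m * (rbinom (- alpha) + fpsC m)) -
   resolvent m * (resolvent l * (rbinom (- alpha) + fpsC l)))).
  by rewrite !resolventE// !mulr1 mulrBr.
ring.
Qed.

Lemma relax_diff_lower l m n : 0 <= l -> l <= m ->
  (m - l) * (relax l n * (1 - relax m n)) <= m * (relax l n - relax m n).
Proof.
move=> l0 lm; have m0 := le_trans l0 lm.
rewrite relax_diff// [leRHS]mulrCA ler_wpM2l ?subr_ge0//.
rewrite [relax m n]relax_sum// subKr mulrCA ler_wpM2l// mulrC mulr_suml.
rewrite [_ * resolvent m]mulrC fpsM; apply: ler_sum => i _.
by rewrite ler_wpM2l ?resolvent_ge0// relax_nonincr// leq_subr.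
Qed.

Lemma relax_diff_upper l m n : 0 <= l -> l <= m ->
  m * (relax l n - relax m n) <= (m - l) * (1 - relax m n).
Proof.
move=> l0 lm; have m0 := le_trans l0 lm.
rewrite relax_diff// mulrCA ler_wpM2l ?subr_ge0//.
rewrite [relax m n]relax_sum// subKr ler_wpM2l//.
rewrite [_ * resolvent m]mulrC fpsM; apply: ler_sum => i _.
by rewrite ler_piMr ?resolvent_ge0// relax_le1.
Qed.

(** The expansion in powers of [l] is geometric, so the remainder is the first omitted
    power times [relax], hence bounded by the first omitted term whatever the size of
    [l]. *)
Lemma relax_expansion l (M : nat) n : 0 <= l ->
  `|relax l n - \sum_(k < M) (- l) ^+ k * rbinom (alpha * k%:R + 1) n|
    <= l ^+ M * rbinom (alpha * M%:R + 1) n.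
Proof.
case/andP: alpha01 => a0 a1 l0.
have H : relax l - \sum_(k < M) fpsC ((- l) ^+ k) * rbinom (alpha * k%:R + 1) =
    fpsC ((- l) ^+ M) * (rbinom (alpha * M%:R) * relax l).
  elim: M => [|M IH].
    rewrite big_ord0 subr0 mulr0 rbinom_zero mul1r expr0.
    by apply/funext => k; rewrite fpsCM mul1r.
  rewrite big_ord_recr/= opprD addrA IH.
  have -> : fpsC ((- l) ^+ M.+1) = - (fpsC ((- l) ^+ M) * fpsC l) :> fps R.
    by apply/funext => -[|k]; rewrite fpsN fpsCM/= ?mulr0 ?oppr0// exprS; ring.
  have -> : rbinom (alpha * M.+1%:R) = rbinom (alpha * M%:R) * rbinom alpha :> fps R.
    by rewrite -rbinomD; congr rbinom; rewrite -natr1; ring.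
  rewrite rbinomD -(relax_renewal l0).
  ring.
have {H} /(congr1 (fun f : fps R => f n)) := H.
rewrite fpsD fpsN fps_sum_coef; under eq_bigr do rewrite fpsCM.
move=> ->; rewrite fpsCM normrM normrX normrN (ger0_norm l0) ler_wpM2l ?exprn_ge0//.
have aM0 : 0 <= alpha * M%:R by rewrite mulr_ge0// ltW.
rewrite ger0_norm; last first.
  by apply: fps_ge0M => i; [exact: rbinom_ge0|exact: relax_ge0].
rewrite [alpha * _ + 1]addrC rbinomD fps_sumE fpsM; apply: ler_sum => i _.
by rewrite ler_piMr ?rbinom_ge0// relax_le1.
Qed.

End discrete_relaxation.

(** * Euler's limit formula for Gamma *)

Section gamma_limit.
Context {R : realType}.
Notation mu := (@lebesgue_measure R).
Implicit Types (a c t : R) (n : nat).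

Lemma powR_le_expR a c t : 0 <= a -> 0 < c -> 0 < t ->
  t `^ a <= ((a + 1) / c) `^ a * expR (c * t).
Proof.
move=> a0 c0 t0; have a1 : 0 < a + 1 by rewrite ltr_wpDl.
have -> : t `^ a = ((a + 1) / c) `^ a * (c * t / (a + 1)) `^ a.
  rewrite -powRM; [congr (_ `^ _); field; lra| |]; by rewrite divr_ge0// ?mulr_ge0// ltW.
rewrite ler_wpM2l ?powR_ge0//.
have y0 : 0 <= c * t / (a + 1) by rewrite divr_ge0 ?mulr_ge0// ltW.
have ye : c * t / (a + 1) <= expR (c * t / (a + 1)).
  by apply: le_trans (expR_ge1Dx _); rewrite lerDr.
apply: le_trans (_ : expR (c * t / (a + 1)) `^ a <= _).
  by apply: ge0_ler_powR => //; rewrite nnegrE ?expR_ge0.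
rewrite -expRM ler_expR -mulrA ler_piMr ?mulr_ge0 ?(ltW c0) ?(ltW t0)//.
by rewrite mulrC ler_pdivrMr// mul1r lerDl.
Qed.

Lemma onem_exp_le t : 1 - t <= expR (- t).
Proof. exact: expR_ge1Dx. Qed.

Lemma onem_expn_le n t : t <= n.+1%:R -> (1 - t / n.+1%:R) ^+ n.+1 <= expR (- t).
Proof.
move=> tn; have n0 : 0 < n.+1%:R :> R by rewrite ltr0n.
have -> : - t = n.+1%:R * - (t / n.+1%:R).
  by rewrite mulrN mulrC mulfVK ?gt_eqF.
rewrite expRM_natl; apply: lerXn2r (onem_exp_le _); rewrite nnegrE ?expR_ge0//.
by rewrite subr_ge0 ler_pdivrMr// mul1r.
Qed.

Lemma onem_expn_ge n t : 0 <= t < n.+1%:R ->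
  expR (- (t / (1 - t / n.+1%:R))) <= (1 - t / n.+1%:R) ^+ n.+1.
Proof.
move=> /andP[t0 tn]; have n0 : 0 < n.+1%:R :> R by rewrite ltr0n.
have y1 : 0 < 1 - t / n.+1%:R by rewrite subr_gt0 ltr_pdivrMr// mul1r.
have -> : - (t / (1 - t / n.+1%:R)) = n.+1%:R * - ((1 - t / n.+1%:R)^-1 - 1).
  move: (n.+1%:R) n0 y1 => m m0 y1.
  have mt : m - t != 0.
    by move: y1; rewrite subr_gt0 ltr_pdivrMr// mul1r => ?; rewrite subr_eq0 gt_eqF.
  by field; rewrite mt gt_eqF.
rewrite expRM_natl; apply: lerXn2r; rewrite ?nnegrE ?expR_ge0 ?(ltW y1)//.
rewrite expRN -[leRHS]invrK lef_pV2 ?posrE ?expR_gt0 ?invr_gt0//.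
by apply: le_trans (expR_ge1Dx _); rewrite [leRHS]addrC subrK.
Qed.

Lemma onem_expn_cvg t : 0 <= t ->
  (1 - t / n.+1%:R) ^+ n.+1 @[n --> \oo] --> expR (- t).
Proof.
move=> t0.
have tn0 : t / n.+1%:R @[n --> \oo] --> (0 : R).
  rewrite -(mulr0 t); apply: cvgMr; exact: cvg_harmonic.
apply: (@squeeze_cvgr _ _ _ _ (fun n => expR (- (t / (1 - t / n.+1%:R))))
  (fun=> expR (- t))); last exact: cvg_cst.
- near=> n; have tn : t < n.+1%:R.
    apply: (@lt_trans _ _ n%:R); last by rewrite ltr_nat.
    by near: n; exact: nbhs_infty_gtr.
  by rewrite onem_expn_ge ?t0//= onem_expn_le// ltW.
- apply: continuous_cvg; first exact: continuous_expR.
  apply: cvgN; rewrite -[X in _ --> X]divr1; apply: cvgMr.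
  apply: cvgV; first exact: oner_neq0.
  by rewrite -[X in _ --> X](subr0 1); apply: cvgB tn0; exact: cvg_cst.
Unshelve. all: by end_near. Qed.

Lemma powR_measurable_fun (D : set R) a : measurable_fun D (fun t : R => t `^ a).
Proof. by apply: measurable_funTS; exact: measurable_powR. Qed.

Lemma beta_integrand_measurable (D : set R) a c n :
  measurable_fun D (fun t : R => t `^ a * (1 - t / c) ^+ n).
Proof.
apply: measurable_funM; first exact: powR_measurable_fun.
apply: measurable_funX; apply: measurable_funB => //.
exact: measurable_funM.
Qed.

Lemma beta_integrand_integrable a c n : 0 <= a -> 0 < c ->
  mu.-integrable `[0, c] (EFin \o (fun t : R => t `^ a * (1 - t / c) ^+ n)).
Proof.
move=> a0 c0; apply: measurable_bounded_integrable => //.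
- by rewrite /= lebesgue_measure_itv/= lte_fin c0 -EFinD ltry.
- exact: beta_integrand_measurable.
- exists (c `^ a); split; first by rewrite num_real.
  move=> M cM t /=; rewrite in_itv/= => /andP[t0 tc].
  have y01 : 0 <= 1 - t / c <= 1.
    by rewrite subr_ge0 ler_pdivrMr// mul1r tc/= gerBl divr_ge0// ltW.
  apply: le_trans (ltW cM); case/andP: y01 => y0 y1.
  rewrite ger0_norm ?mulr_ge0 ?powR_ge0 ?exprn_ge0// -[leRHS]mulr1.
  apply: ler_pM; rewrite ?powR_ge0 ?exprn_ge0 ?exprn_ile1//.
  by apply: ge0_ler_powR => //; rewrite nnegrE// ltW.
Qed.

Lemma Rintegral_powR a c : 0 <= a -> 0 < c ->
  \int[mu]_(t in `[0, c]) (t `^ a) = c `^ (a + 1) / (a + 1).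
Proof.
move=> a0 c0; have a1 : 0 < a + 1 by rewrite ltr_wpDl.
pose F (t : R) := t `^ (a + 1) / (a + 1).
have dF (t : R) : 0 < t -> is_derive t 1 F (t `^ a).
  move=> t0; have -> : t `^ a = (a + 1)^-1 *: ((a + 1) * t `^ (a + 1 - 1)).
    by rewrite addrK /GRing.scale/= mulKf// gt_eqF.
  have -> : F = (a + 1)^-1 \*: (fun y : R => y `^ (a + 1)) :> (R -> R^o).
    by apply/funext => y; rewrite /F /= mulrC.
  by apply: is_deriveZ; exact: is_derive1_powR.
have cP (t : R) : 0 < t -> {for t, continuous (fun y : R => y `^ a)}.
  move=> t0; apply: differentiable_continuous; apply/derivable1_diffP.
  by apply: derivable_powR; rewrite in_itv/= t0.
have cF (t : R) : 0 < t -> {for t, continuous F}.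
  move=> t0; apply: differentiable_continuous; apply/derivable1_diffP.
  by have [] := dF t t0.
rewrite /Rintegral (@continuous_FTC2 _ _ F 0 c)//.
- by rewrite -EFinB /F powR0 ?gt_eqF// mul0r subr0.
- apply/continuous_within_itvP => //; split.
  + by move=> t; rewrite in_itv/= => /andP[t0 _]; exact: cP.
  + have [->|an0] := eqVneq a 0.
      by under eq_cvg do rewrite powRr0; rewrite powRr0; exact: cvg_cst.
    by rewrite powR0//; apply: powR_cvg0; rewrite lt_neqAle eq_sym an0.
  + by apply: cvg_at_left_filter; exact: cP.
- split.
  + by move=> t; rewrite in_itv/= => /andP[t0 _]; have [] := dF t t0.
  + rewrite [F 0]/F powR0 ?gt_eqF// mul0r -[X in _ --> X](mul0r (a + 1)^-1).
    by apply: cvgMl; exact: powR_cvg0.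
  + by apply: cvg_at_left_filter; exact: cF.
- by move=> t; rewrite in_itv/= => /andP[t0 _]; rewrite derive1E; have [_ ->] := dF t t0.
Qed.

(** Induction on [n] through [y^a (1 - y)^(n+1) = y^a (1 - y)^n - y^(a+1) (1 - y)^n],
    which spares the integration by parts. *)
Lemma Rintegral_beta a c n : 0 <= a -> 0 < c ->
  \int[mu]_(t in `[0, c]) (t `^ a * (1 - t / c) ^+ n) =
  c `^ (a + 1) / ((a + n.+1%:R) * rbinom (a + 1) n).
Proof.
move=> a0 c0; elim: n a a0 => [|n IH] a a0.
  under eq_Rintegral do rewrite expr0 mulr1.
  by rewrite Rintegral_powR// rbinom0 mulr1.
have a1 : 0 < a + 1 by rewrite ltr_wpDl.
transitivity (\int[mu]_(t in `[0, c]) (t `^ a * (1 - t / c) ^+ n -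
    c^-1 * (t `^ (a + 1) * (1 - t / c) ^+ n))).
  apply: eq_Rintegral => t; rewrite inE/= in_itv/= => /andP[t0 tc].
  rewrite powRD; last by rewrite gt_eqF.
  by rewrite powRr1// exprS; ring.
rewrite RintegralB//=; last 2 first.
- exact: beta_integrand_integrable.
- apply: eq_integrable (integrableZl _ c^-1 (beta_integrand_integrable n (ltW a1) c0)) => //.
rewrite RintegralZl//; last by apply: beta_integrand_integrable => //; exact: ltW.
rewrite IH// IH ?(ltW a1)//.
have -> : rbinom (a + 1) n.+1 = rbinom (a + 1) n * ((a + 1 + n%:R) / n.+1%:R).
  exact: rbinomS.
have -> : rbinom (a + 1 + 1) n = rbinom (a + 1) n * ((a + 1 + n%:R) / (a + 1)).
  apply: (mulfI (lt0r_neq0 a1)); rewrite rbinom_shift.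
  by field; exact: lt0r_neq0.
rewrite [c `^ (a + 1 + 1)]powRD ?(gt_eqF c0) ?implybT// powRr1 ?ltW//.
have : rbinom (a + 1) n != 0 by rewrite gt_eqF// rbinom_gt0.
have n0 : 0 <= n%:R :> R by [].
rewrite -[n.+2%:R]natr1 -[n.+1%:R]natr1.
move: (c `^ (a + 1)) (rbinom (a + 1) n) (n%:R) n0 => C r N N0 r0.
field.
rewrite r0 !gt_eqF//=; lra.
Qed.

Lemma gamma_integrand_cvg a (D := `]0, +oo[%classic : set R) : 0 <= a ->
  ((\int[mu]_(t in D)
     ((fun t : R => (t `^ a * (1 - t / n.+1%:R) ^+ n.+1)%:E) \_ `[0%R, n.+1%:R]) t)%E
    @[n --> \oo] --> (\int[mu]_(t in D) (t `^ a * expR (- t))%:E)%E) /\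
  mu.-integrable D (fun t => (t `^ a * expR (- t))%:E).
Proof.
move=> a0; have h0 : 0 < 2^-1 :> R by rewrite invr_gt0.
have mD : measurable D by exact: measurable_itv.
pose C := ((a + 1) / 2^-1) `^ a.
pose G := fun t : R => ((2 * C)%:E * (EFin \o exponential_pdf 2^-1) t)%E.
have iG : mu.-integrable D G.
  apply: integrableS (integrableZl measurableT (2 * C) (integrable_exponential_pdf h0)) => //.
have Dt0 t : D t -> 0 < t by rewrite /D /= in_itv/= andbT.
have leG t : D t -> t `^ a * expR (- t) <= 2 * C * exponential_pdf 2^-1 t.
  move=> /Dt0 t0; rewrite exponential_pdfE ?(ltW t0)//.
  rewrite mulrACA divff// mul1r -/C.
  have := powR_le_expR a0 h0 t0; rewrite -/C => H.
  apply: le_trans (ler_wpM2r (expR_ge0 _) H) _.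
  by rewrite -mulrA -expRD (_ : 2^-1 * t + - t = - 2^-1 * t) ?lexx//; lra.
split.
- pose f_ := fun n : nat =>
    (fun t : R => (t `^ a * (1 - t / n.+1%:R) ^+ n.+1)%:E) \_ `[0%R, n.+1%:R].
  apply: (@dominated_cvg _ _ _ mu D mD f_ (fun t => (t `^ a * expR (- t))%:E) G) => //.
  + move=> n; apply: (measurable_restrict _ _ _).1 => //.
    by apply/measurable_EFinP; exact: beta_integrand_measurable.
  + move=> t /Dt0 t0.
    apply: (@cvg_trans _ ((t `^ a * (1 - t / n.+1%:R) ^+ n.+1)%:E @[n --> \oo])).
      apply: near_eq_cvg; near=> n; rewrite /f_ patchE mem_set//=.
      rewrite in_itv/= (ltW t0)/= (@le_trans _ _ n%:R) ?ler_nat// ltW//.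
      by near: n; exact: nbhs_infty_gtr.
    apply: cvg_EFin; first exact: nearW.
    by apply: cvgMr; apply: onem_expn_cvg; exact: ltW.
  + move=> n t Dt; apply: le_trans (_ : (t `^ a * expR (- t))%:E <= _)%E; last first.
      by rewrite /G /= -EFinM lee_fin; exact: leG.
    rewrite /f_ patchE; case: ifPn => [|_]; last first.
      by rewrite abse0 lee_fin mulr_ge0 ?powR_ge0 ?expR_ge0.
    rewrite inE/= in_itv/= => /andP[t0 tn].
    have y0 : 0 <= 1 - t / n.+1%:R by rewrite subr_ge0 ler_pdivrMr// mul1r.
    rewrite lee_fin ger0_norm ?mulr_ge0 ?powR_ge0 ?exprn_ge0//.
    by rewrite ler_wpM2l ?powR_ge0// onem_expn_le.
- apply: le_integrable iG => //.
  + apply/measurable_EFinP; apply: measurable_funM; first exact: powR_measurable_fun.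
    by apply: measurableT_comp => //; exact: measurableT_comp.
  + move=> t Dt /=; rewrite ger0_norm ?mulr_ge0 ?powR_ge0 ?expR_ge0//.
    by rewrite lee_fin (le_trans (leG _ Dt))// ler_norm.
Unshelve. all: by end_near. Qed.

Lemma beta_cvg_Gamma a : 0 <= a ->
  n.+1%:R `^ (a + 1) / ((a + n.+2%:R) * rbinom (a + 1) n.+1) @[n --> \oo]
    --> Gamma (a + 1).
Proof.
move=> a0; have [H I] := gamma_integrand_cvg a0.
have fI : (\int[mu]_(t in `]0%R, +oo[) (t `^ a * expR (- t))%:E)%E \is a fin_num.
  exact: integrable_fin_num.
rewrite -(fineK fI) in H; move/fine_cvg : H.
rewrite /Gamma addrK /Rintegral; apply: cvg_trans; apply: near_eq_cvg.
near=> n => /=.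
rewrite -Rintegral_beta//; congr fine; rewrite -integral_mkcondr.
have -> : `]0%R, +oo[ `&` `[0%R, n.+1%:R] = `]0%R, n.+1%:R]%classic :> set R.
  apply/seteqP; split => t /=; rewrite !in_itv/= andbT.
    by move=> [t0 /andP[_ ->]]; rewrite t0.
  by move=> /andP[t0 ->]; rewrite t0 ltW.
rewrite integral_itv_obnd_cbnd//.
by apply/measurable_EFinP; exact: beta_integrand_measurable.
Unshelve. all: by end_near. Qed.

Lemma rbinom_powR_nonincr a i j : 0 <= a -> (0 < i)%N -> (i <= j)%N ->
  rbinom (a + 1) j / j%:R `^ a <= rbinom (a + 1) i / i%:R `^ a.
Proof.
move=> a0 i0; elim: j => [|j IH]; first by rewrite leqNgt i0.
rewrite leq_eqVlt => /predU1P[->//|ij]; apply: le_trans (IH ij).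
have j0 : 0 < j%:R :> R by rewrite ltr0n (leq_trans i0).
have jS0 : 0 < j.+1%:R :> R by rewrite ltr0n.
rewrite rbinomS -mulrA ler_wpM2l ?rbinom_ge0 ?addr_ge0//.
rewrite ler_pdivrMr ?powR_gt0// [leRHS]mulrC ler_pdivlMr ?powR_gt0//.
pose y : R := j.+1%:R^-1.
have y1 : 0 <= 1 - y by rewrite subr_ge0 invf_le1// ler1n.
have -> : (j%:R : R) = (1 - y) * j.+1%:R.
  by rewrite mulrBl mulVf ?gt_eqF// mul1r -natr1 addrK.
rewrite powRM// mulrA ler_piMl ?powR_ge0//.
have -> : (a + 1 + (1 - y) * j.+1%:R) / j.+1%:R = 1 + a * y.
  by rewrite /y mulrBl mulVf ?gt_eqF//; field; rewrite gt_eqF.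
apply: le_trans (_ : expR (a * y) * expR (- y * a) <= 1); last first.
  by rewrite -expRD mulNr [y * a]mulrC subrr expR0.
apply: ler_pM; rewrite ?powR_ge0 ?addr_ge0 ?mulr_ge0 ?invr_ge0 ?expR_ge1Dx//.
rewrite expRM; apply: ge0_ler_powR; rewrite ?nnegrE ?expR_ge0//.
exact: onem_exp_le.
Qed.

Lemma Gamma_gt0 a : 0 <= a -> 0 < Gamma (a + 1).
Proof.
move=> a0; have c0 : 0 < ((a + 2) * (a + 1))^-1 by rewrite invr_gt0 mulr_gt0//; lra.
apply: lt_le_trans c0 _; have H := beta_cvg_Gamma a0.
rewrite -(cvg_lim _ H)//; apply: limr_ge; first by apply/cvg_ex; exists (Gamma (a + 1)).
near=> n; have m0 : 0 < n.+1%:R :> R by [].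
have m1 : 1 <= n.+1%:R :> R by rewrite ler1n.
have P0 : 0 < n.+1%:R `^ a by exact: powR_gt0.
have rb0 : 0 < rbinom (a + 1) n.+1 by apply: rbinom_gt0; rewrite ltr_wpDl.
have : rbinom (a + 1) n.+1 <= (a + 1) * n.+1%:R `^ a.
  have := rbinom_powR_nonincr a0 (leqnn 1) (ltn0Sn n).
  by rewrite (rbinomS _ 0) rbinom0 mul1r addr0 divr1 powR1 divr1 ler_pdivrMr.
have -> : n.+1%:R `^ (a + 1) = n.+1%:R `^ a * n.+1%:R.
  by rewrite powRD ?(gt_eqF m0) ?implybT// powRr1 ?(ltW m0).
rewrite -[n.+2%:R]natr1.
move: (n.+1%:R) (n.+1%:R `^ a) (rbinom _ _) m0 m1 P0 rb0 => m p r m0 m1 p0 r0 rp.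
have ma : 0 < a + (m + 1) by lra.
rewrite ler_pdivlMr ?mulr_gt0// mulrC ler_pdivrMr; last by rewrite mulr_gt0//; lra.
apply: le_trans (_ : (a + (m + 1)) * ((a + 1) * p) <= _); first by rewrite ler_pM2l.
rewrite -subr_ge0 (_ : _ - _ = (p * (a + 1)) * ((a + 1) * (m - 1))); last by ring.
by rewrite !mulr_ge0 ?(ltW p0) ?subr_ge0//; lra.
Unshelve. all: by end_near. Qed.

Lemma rbinom_cvg a : 0 <= a ->
  rbinom (a + 1) n.+1 / n.+1%:R `^ a @[n --> \oo] --> (Gamma (a + 1))^-1.
Proof.
move=> a0; have H := beta_cvg_Gamma a0; have G0 := Gamma_gt0 a0.
have H1 : (1 + (a + 1) / n.+1%:R)^-1 @[n --> \oo] --> (1 : R).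
  rewrite -[X in _ --> X]invr1; apply: cvgV; first exact: oner_neq0.
  rewrite -[X in _ --> X]addr0; apply: cvgD; first exact: cvg_cst.
  by rewrite -[X in _ --> X](mulr0 (a + 1)); apply: cvgMr; exact: cvg_harmonic.
rewrite -[X in _ --> X]mul1r.
apply: cvg_trans (cvgM H1 (cvgV (lt0r_neq0 G0) H)).
apply: near_eq_cvg; near=> n => /=.
have m0 : 0 < n.+1%:R :> R by [].
have P0 : 0 < n.+1%:R `^ a by exact: powR_gt0.
have rb0 : 0 < rbinom (a + 1) n.+1 by apply: rbinom_gt0; rewrite ltr_wpDl.
have -> : n.+1%:R `^ (a + 1) = n.+1%:R `^ a * n.+1%:R.
  by rewrite powRD ?(gt_eqF m0) ?implybT// powRr1 ?(ltW m0).
rewrite -[n.+2%:R]natr1.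
move: (n.+1%:R) (n.+1%:R `^ a) (rbinom _ _) m0 P0 rb0 => m p r m0 p0 r0.
by field; rewrite !gt_eqF//=; lra.
Unshelve. all: by end_near. Qed.

Lemma rbinom_invGamma_le a n : 0 <= a ->
  (Gamma (a + 1))^-1 <= rbinom (a + 1) n.+1 / n.+1%:R `^ a.
Proof.
move=> a0; have H := rbinom_cvg a0; rewrite -(cvg_lim _ H)//.
apply: limr_le; first by apply/cvg_ex; exists (Gamma (a + 1))^-1.
by exists n => // k /= nk; apply: rbinom_powR_nonincr.
Qed.

Lemma Gamma1 : Gamma 1 = 1 :> R.
Proof.
have := @rbinom_cvg 0 (lexx 0); rewrite add0r => H.
apply: invr_inj; rewrite invr1; rewrite -(cvg_lim _ H)//.
under eq_fun do rewrite rbinom_one powRr0 divr1.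
exact: lim_cst.
Qed.

End gamma_limit.

(** * The Mittag-Leffler function on the negative half-line *)

Section mittag_leffler_negative.
Context {R : realType} (alpha : R) (alpha01 : 0 < alpha < 1).
Implicit Types (x y : R) (n k : nat).

Notation ML := (MittagLeffler alpha).
Notation ML_term x := (fun k : nat => x ^+ k / Gamma (alpha * k%:R + 1)).

Let alpha_gt0 : 0 < alpha. Proof. by case/andP: alpha01. Qed.

Let alphak_ge0 k : 0 <= alpha * k%:R. Proof. by rewrite mulr_ge0// ltW. Qed.

(** A geometric majorant, uniform in [n], for the terms of both the series and
    its discretisation: the rescaled coefficient decreases in [n], so it suffices to bound
    it at one [N], chosen so large that the powers of [x] are absorbed. *)
Lemma ML_majorant x : 0 <= x -> exists N : nat, exists2 C : R, 0 <= C &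
  forall n k, (N <= n)%N ->
    x ^+ k * (rbinom (alpha * k%:R + 1) n.+1 / n.+1%:R `^ (alpha * k%:R))
      <= C * 2^-1 ^+ k.
Proof.
move=> x0; pose B := 4 * (x + 1).
have B0 : 0 < B by rewrite mulr_gt0// ltr_wpDl.
pose N := Num.truncn (B `^ alpha^-1).
exists N, (2 ^+ N.+1) => [|n k Nn]; first by rewrite exprn_ge0.
have NB : B <= N.+1%:R `^ alpha.
  have -> : B = (B `^ alpha^-1) `^ alpha.
    by rewrite -powRrM mulVf ?gt_eqF// powRr1// ltW.
  apply: ge0_ler_powR; rewrite ?nnegrE ?powR_ge0//; first exact: ltW.
  by apply: ltW; rewrite truncnS_gt.
apply: le_trans (_ : x ^+ k * (2 ^+ (N.+1 + k) / B ^+ k) <= _).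
  rewrite ler_wpM2l ?exprn_ge0//.
  apply: le_trans (rbinom_powR_nonincr (alphak_ge0 k) (ltn0Sn N) (Nn : (N.+1 <= n.+1)%N)) _.
  apply: ler_pM; rewrite ?invr_ge0 ?powR_ge0//.
  - by apply: rbinom_ge0; rewrite addr_ge0.
  - apply: le_trans (rbinom_nat_le k N.+1); apply: rbinom_le; rewrite ?addr_ge0//.
    by rewrite lerD2r ler_piMl//; case/andP: alpha01 => _ /ltW.
  - rewrite lef_pV2 ?posrE ?powR_gt0 ?exprn_gt0// powRrM powR_mulrn ?powR_ge0//.
    by apply: lerXn2r; rewrite ?nnegrE ?powR_ge0 ?(ltW B0).
rewrite exprD -mulrA mulrCA ler_wpM2l ?exprn_ge0//.
rewrite -expr_div_n -exprMn; apply: lerXn2r.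
- by rewrite nnegrE mulr_ge0 ?divr_ge0// ltW.
- by rewrite nnegrE.
- by rewrite mulrA ler_pdivrMr// /B; lra.
Qed.

Lemma ML_term_le x : 0 <= x -> exists2 C : R, 0 <= C &
  forall k, `|ML_term x k| <= C * 2^-1 ^+ k.
Proof.
move=> x0; have [N [C C0 H]] := ML_majorant x0; exists C => // k.
have G0 := Gamma_gt0 (alphak_ge0 k).
rewrite normrM normrX (ger0_norm x0) gtr0_norm ?invr_gt0//.
apply: le_trans (H N k (leqnn N)); rewrite ler_wpM2l ?exprn_ge0//.
exact: rbinom_invGamma_le.
Qed.

Lemma is_cvg_ML x : cvgn (series (ML_term x)).
Proof.
apply: normed_cvg; have [C C0 H] := ML_term_le (normr_ge0 x).
apply: (@series_le_cvg _ _ (fun k => C * 2^-1 ^+ k)).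
- by move=> k; exact: normr_ge0.
- by move=> k; rewrite mulr_ge0 ?exprn_ge0.
- by move=> k; apply: le_trans (H k); rewrite /= !normrM !normrX normr_id lexx.
- by apply: is_cvg_geometric_series; rewrite ger0_norm// invf_lt1// ltr1n.
Qed.

Lemma ML0 : ML 0 = 1.
Proof.
rewrite /MittagLeffler; apply: norm_lim_near_cst.
exists 1%N => // -[//|n] _; rewrite seriesEnat/= big_nat_recl// big1 ?addr0.
  by rewrite expr0 mulr0 add0r Gamma1 divr1.
by move=> k _; rewrite expr0n/= mul0r.
Qed.

Lemma ML_gt1 x : 0 < x -> 1 < ML x.
Proof.
move=> x0; have G k := Gamma_gt0 (alphak_ge0 k).
apply: (@lt_le_trans _ _ (1 + x / Gamma (alpha * 1%:R + 1))).
  by rewrite ltrDl divr_gt0.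
apply: limr_ge; first exact: is_cvg_ML.
exists 2%N => // -[//|[//|n]] _; rewrite seriesEnat/= 2?big_nat_recl//=.
rewrite expr0 mulr0 add0r Gamma1 divr1 expr1 lerD2l lerDl.
by apply: sumr_ge0 => k _; rewrite divr_ge0 ?exprn_ge0 ?ltW.
Qed.

(** The discretisation step that makes the [n]-th term of [relax] tend to the
    Mittag-Leffler function. *)
Definition ML_step x n : R := x / n.+1%:R `^ alpha.

Lemma ML_step_ge0 x n : 0 <= x -> 0 <= ML_step x n.
Proof. by move=> x0; rewrite divr_ge0 ?powR_ge0. Qed.

Lemma ML_stepX x n k : ML_step x n ^+ k = x ^+ k / n.+1%:R `^ (alpha * k%:R).
Proof. by rewrite exprMn exprVn powRrM powR_mulrn ?powR_ge0. Qed.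

(** The first [M] terms of the expansion of [relax] converge one by one to those of the
    series; the remainder of the expansion is at most [C / 2 ^ M] for all large [n]. *)
Lemma relax_cvg_ML x : 0 <= x ->
  relax alpha (ML_step x n) n.+1 @[n --> \oo] --> ML (- x).
Proof.
move=> x0; have [N [C C0 HC]] := ML_majorant x0.
pose S M n := \sum_(k < M)
  (- ML_step x n) ^+ k * rbinom (alpha * k%:R + 1) n.+1.
have cS M : S M n @[n --> \oo] --> series (ML_term (- x)) M.
  rewrite seriesEord /= /S; elim: M => [|k IH].
    by under eq_cvg do rewrite big_ord0; rewrite big_ord0; exact: cvg_cst.
  under eq_cvg do rewrite big_ord_recr/=.
  rewrite big_ord_recr/=; apply: cvgD IH _.
  apply: cvg_trans (cvgM (cvg_cst ((- x) ^+ k)) (rbinom_cvg (alphak_ge0 k))).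
  apply: near_eq_cvg; near=> n => /=.
  have -> : (- ML_step x n) ^+ k = (- x) ^+ k / n.+1%:R `^ (alpha * k%:R).
    by rewrite exprNn ML_stepX [(- x) ^+ k]exprNn mulrA.
  by rewrite mulrA mulrAC.
apply/cvgrPdist_le => /= e e0.
have e3 : 0 < e / 3 by rewrite divr_gt0.
have cM : cvgn (series (ML_term (- x))) by exact: is_cvg_ML.
have gC : C * 2^-1 ^+ M @[M --> \oo] --> 0.
  rewrite -[X in _ --> X](mulr0 C); apply: cvgMr; apply: cvg_expr.
  by rewrite ger0_norm// invf_lt1// ltr1n.
have [M [HM1 HM2]] : exists M, `|ML (- x) - series (ML_term (- x)) M| <= e / 3 /\
    C * 2^-1 ^+ M <= e / 3.
  have : \forall M \near \oo,
      `|ML (- x) - series (ML_term (- x)) M| <= e / 3 /\ C * 2^-1 ^+ M <= e / 3.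
    near=> M; split; near: M.
      by move/cvgrPdist_le : cM; exact.
    move/cvgrPdist_le : gC => /(_ _ e3); apply: filterS => M.
    by rewrite sub0r normrN ger0_norm// mulr_ge0 ?exprn_ge0.
  by move=> [M _ HM]; exists M; apply: HM => /=.
near=> n.
have Nn : (N <= n)%N by near: n; exact: nbhs_infty_ge.
have h1 : `|series (ML_term (- x)) M - S M n| <= e / 3.
  by near: n; move/cvgrPdist_le : (cS M); exact.
have h2 : `|relax alpha (ML_step x n) n.+1 - S M n| <= e / 3.
  apply: le_trans (relax_expansion alpha01 _ _ (ML_step_ge0 n x0)) _.
  apply: le_trans HM2; apply: le_trans (HC n M Nn).
  by rewrite ML_stepX -mulrA [_^-1 * _]mulrC.
have -> : ML (- x) - relax alpha (ML_step x n) n.+1 =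
    (ML (- x) - series (ML_term (- x)) M) + (series (ML_term (- x)) M - S M n)
    - (relax alpha (ML_step x n) n.+1 - S M n) by ring.
apply: le_trans (ler_normB _ _) _; apply: le_trans (lerD (ler_normD _ _) (lexx _)) _.
by apply: le_trans (lerD (lerD HM1 h1) h2) _; lra.
Unshelve. all: by end_near. Qed.

End mittag_leffler_negative.

Section mittag_leffler_bounds.
Context {R : realType} (alpha : R) (alpha01 : 0 < alpha < 1).
Implicit Types (x y u w : R) (n k : nat).

Notation ML := (MittagLeffler alpha).

Let alpha_gt0 : 0 < alpha. Proof. by case/andP: alpha01. Qed.

Definition ML_slope : R := (Gamma (alpha + 1))^-1.

Lemma ML_slope_gt0 : 0 < ML_slope.
Proof. by rewrite invr_gt0 Gamma_gt0// ltW. Qed.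

Lemma ML_step_rbinom_cvg x :
  ML_step alpha x n * rbinom (alpha + 1) n.+1 @[n --> \oo] --> x * ML_slope.
Proof.
apply: cvg_trans (cvgM (cvg_cst x) (rbinom_cvg (ltW alpha_gt0))).
apply: near_eq_cvg; near=> n => /=.
by rewrite /ML_step mulrA mulrAC.
Unshelve. all: by end_near. Qed.

Lemma ML_neg_upper x : 0 <= x -> ML (- x) * (1 + x * ML_slope) <= 1.
Proof.
move=> x0; have H := relax_cvg_ML alpha01 x0.
have K : 1 + ML_step alpha x n * rbinom (alpha + 1) n.+1 @[n --> \oo]
    --> 1 + x * ML_slope.
  by apply: cvgD; [exact: cvg_cst|exact: ML_step_rbinom_cvg].
apply: (ler_cvg_to (cvgM H K) (cvg_cst _)).
by near=> n; apply: relax_upper => //; exact: ML_step_ge0.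
Unshelve. all: by end_near. Qed.

Lemma ML_neg_lipschitz0 x : 0 <= x -> 1 - ML (- x) <= x * ML_slope.
Proof.
move=> x0; have H := relax_cvg_ML alpha01 x0.
apply: (ler_cvg_to (cvgB (cvg_cst (1 : R)) H) (@ML_step_rbinom_cvg x)).
by near=> n; apply: relax_lower1 => //; exact: ML_step_ge0.
Unshelve. all: by end_near. Qed.

Lemma onem_powR_le (y : R) : 0 <= y <= 1 -> (1 - y) `^ alpha <= 1 - alpha * y.
Proof.
case/andP: alpha01 => a0 a1 /andP[y0 y1].
have y1' : 0 <= 1 - y by rewrite subr_ge0.
have b0 : 0 < 1 - alpha by rewrite subr_gt0.
have := @conjugate_powR _ ((1 - y) `^ alpha) 1 alpha^-1 (1 - alpha)^-1.
rewrite powR_ge0 ler01 !invr_gt0 a0 b0 !invrK.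
move=> /(_ isT isT isT isT); rewrite mulr1 powR1 -powRrM mulfV ?gt_eqF// powRr1//.
by move=> H; apply: le_trans (H _) _; lra.
Qed.

Lemma rbinom_lower n : 1 - alpha <= rbinom (1 - alpha) n.+1 * n.+1%:R `^ alpha.
Proof.
case/andP: alpha01 => a0 a1.
elim: n => [|n IH]; first by rewrite rbinomS rbinom0 addr0 mul1r divr1 powR1 mulr1.
apply: le_trans IH _; rewrite (rbinomS _ n.+1) -mulrA.
rewrite ler_wpM2l ?rbinom_ge0 ?subr_ge0 ?(ltW a1)//.
have j0 : 0 < n.+2%:R :> R by [].
pose y : R := n.+2%:R^-1.
have y01 : 0 <= y <= 1 by rewrite invr_ge0 ler0n invf_le1// ler1n.
have -> : (n.+1%:R : R) = (1 - y) * n.+2%:R.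
  by rewrite mulrBl mulVf ?gt_eqF// mul1r -[n.+2%:R]natr1 addrK.
have y1 : 0 <= 1 - y by rewrite subr_ge0; case/andP: y01.
rewrite powRM// ler_wpM2r ?powR_ge0//.
apply: le_trans (onem_powR_le y01) _.
have -> : (1 - alpha + (1 - y) * n.+2%:R) / n.+2%:R = 1 - alpha * y.
  by rewrite /y mulrBl mulVf ?gt_eqF//; field; rewrite gt_eqF.
by [].
Qed.

Lemma ML_neg_lower x : 0 <= x -> (1 - alpha) * (1 - ML (- x)) <= x * ML (- x).
Proof.
case/andP: alpha01 => a0 a1.
move=> x0; have H := relax_cvg_ML alpha01 x0.
apply: (ler_cvg_to (cvgM (cvg_cst (1 - alpha)) (cvgB (cvg_cst (1 : R)) H))
  (cvgM (cvg_cst x) H)); near=> n => /=.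
have s0 := ML_step_ge0 alpha n x0; set f := relax _ _ _.
have P0 : 0 < n.+1%:R `^ alpha :> R by exact: powR_gt0.
have f1 : 0 <= 1 - f by rewrite subr_ge0 relax_le1.
apply: le_trans (ler_wpM2r f1 (rbinom_lower n)) _; rewrite mulrAC.
have := relax_lower alpha01 n.+1 s0; rewrite -/f /ML_step [leRHS]mulrAC.
by rewrite ler_pdivlMr.
Unshelve. all: by end_near. Qed.

Lemma ML_neg_gt0 x : 0 <= x -> 0 < ML (- x).
Proof.
case/andP: alpha01 => a0 a1 x0; have := ML_neg_lower x0.
rewrite mulrBr mulr1 lerBlDr -mulrDl => H.
have b0 : 0 < 1 - alpha by rewrite subr_gt0.
have := lt_le_trans b0 H; rewrite pmulr_rgt0//; lra.
Qed.

Lemma ML_neg_diff_lower x y : 0 <= x -> x <= y ->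
  (y - x) * (ML (- x) * (1 - ML (- y))) <= y * (ML (- x) - ML (- y)).
Proof.
move=> x0 xy; have y0 := le_trans x0 xy.
have H := relax_cvg_ML alpha01 x0; have K := relax_cvg_ML alpha01 y0.
apply: (ler_cvg_to (cvgM (cvg_cst (y - x)) (cvgM H (cvgB (cvg_cst (1 : R)) K)))
  (cvgM (cvg_cst y) (cvgB H K))); near=> n => /=.
have P0 : 0 < n.+1%:R `^ alpha :> R by exact: powR_gt0.
have := @relax_diff_lower _ _ alpha01 _ _ n.+1 (ML_step_ge0 alpha n x0)
  (_ : _ <= ML_step alpha y n).
rewrite ler_pM2r ?invr_gt0// => /(_ xy).
by rewrite {1 2 5}/ML_step -mulrBl mulrAC [y / _ * _]mulrAC ler_pM2r ?invr_gt0.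
Unshelve. all: by end_near. Qed.

Lemma ML_neg_diff_upper x y : 0 <= x -> x <= y ->
  y * (ML (- x) - ML (- y)) <= (y - x) * (1 - ML (- y)).
Proof.
move=> x0 xy; have y0 := le_trans x0 xy.
have H := relax_cvg_ML alpha01 x0; have K := relax_cvg_ML alpha01 y0.
apply: (ler_cvg_to (cvgM (cvg_cst y) (cvgB H K))
  (cvgM (cvg_cst (y - x)) (cvgB (cvg_cst (1 : R)) K))); near=> n => /=.
have P0 : 0 < n.+1%:R `^ alpha :> R by exact: powR_gt0.
have := @relax_diff_upper _ _ alpha01 _ _ n.+1 (ML_step_ge0 alpha n x0)
  (_ : _ <= ML_step alpha y n).
rewrite ler_pM2r ?invr_gt0// => /(_ xy).
by rewrite {1 4 5}/ML_step -mulrBl mulrAC [(y - x) / _ * _]mulrAC ler_pM2r ?invr_gt0.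
Unshelve. all: by end_near. Qed.

Lemma ML_neg_lipschitz x y : 0 <= x -> x <= y ->
  0 <= ML (- x) - ML (- y) <= ML_slope * (y - x).
Proof.
rewrite le_eqVlt => /predU1P[<-|x0].
  rewrite oppr0 ML0// addr0 => y0; rewrite [_ * y]mulrC ML_neg_lipschitz0// andbT.
  have := ML_neg_upper y0; have := ML_neg_gt0 y0 => f0 H.
  rewrite subr_ge0; apply: le_trans H; rewrite ler_peMr ?(ltW f0)//.
  by rewrite lerDl mulr_ge0// ltW// ML_slope_gt0.
move=> xy; have y0 := lt_le_trans x0 xy.
have f1 : 0 <= 1 - ML (- y).
  have := ML_neg_upper (ltW y0); have := ML_neg_gt0 (ltW y0) => f0 H.
  rewrite subr_ge0; apply: le_trans H; rewrite ler_peMr ?(ltW f0)//.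
  by rewrite lerDl mulr_ge0 ?ltW// ML_slope_gt0.
apply/andP; split.
  rewrite -(pmulr_rge0 _ y0); apply: le_trans (ML_neg_diff_lower (ltW x0) xy).
  apply: mulr_ge0; first by rewrite subr_ge0.
  by rewrite mulr_ge0// ltW// ML_neg_gt0// ltW.
rewrite -(ler_pM2l y0); apply: le_trans (ML_neg_diff_upper (ltW x0) xy) _.
rewrite mulrC [leRHS]mulrA ler_wpM2r ?subr_ge0//.
exact: ML_neg_lipschitz0 (ltW y0).
Qed.

Lemma ML_neg_surj u : 0 < u <= 1 -> exists2 x, 0 <= x & ML (- x) = u.
Proof.
case/andP=> u0 u1; have k0 := ML_slope_gt0.
pose b := u^-1 / ML_slope.
have b0 : 0 <= b.
  apply: ltW; apply: divr_gt0 => //.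
  by rewrite invr_gt0.
pose F x := ML (- Num.max x 0).
have LF x y : `|F x - F y| <= ML_slope * `|x - y|.
  wlog xy : x y / x <= y => [H|].
    by have [/H//|/ltW/H] := leP x y; rewrite distrC [in X in _ -> X](distrC x).
  have x0 : 0 <= Num.max x 0 by rewrite le_max lexx orbT.
  have mm : Num.max x 0 <= Num.max y 0 by rewrite ge_max !le_max xy lexx orbT.
  have /andP[h1 h2] := ML_neg_lipschitz x0 mm.
  rewrite ger0_norm//; apply: le_trans h2 _; rewrite ler_wpM2l ?(ltW k0)//.
  rewrite distrC ger0_norm ?subr_ge0//.
  have [hx|/ltW hx] := leP 0 x; rewrite ?(max_idPl hx) ?(max_idPr hx);
  have [hy|/ltW hy] := leP 0 y; rewrite ?(max_idPl hy) ?(max_idPr hy); lra.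
have cF : continuous F.
  move=> x; apply/cvgrPdist_le => /= e e0.
  have ek : 0 < e / ML_slope by rewrite divr_gt0.
  near=> y; apply: le_trans (LF x y) _; rewrite mulrC -ler_pdivlMr//.
have cf : {within `[0, b], continuous F} by exact: continuous_subspaceT.
have fb : ML (- b) <= u.
  have := ML_neg_upper b0; rewrite /b divfK ?gt_eqF// => H.
  have f0 := ML_neg_gt0 b0; rewrite -/b in H.
  have : ML (- b) * u^-1 <= 1 by apply: le_trans H; rewrite ler_pM2l// lerDr.
  by rewrite ler_pdivrMr// mul1r.
have [|c cb fc] := @IVT _ F 0 b u b0 cf.
  rewrite /F maxxx oppr0 ML0// (max_idPl b0).
  by rewrite ge_min fb orbT le_max u1.
move: cb; rewrite in_itv/= => /andP[c0 _]; exists c => //.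
by move: fc; rewrite /F (max_idPl c0).
Unshelve. all: by end_near. Qed.

End mittag_leffler_bounds.

(** * The integrand as a function of the distribution function *)

Section kernel.
Context {R : realType} (alpha : R) (alpha01 : 0 < alpha < 1).
Implicit Types (x y u w : R) (n k : nat).

Notation ML := (MittagLeffler alpha).
Notation kappa := (ML_slope alpha).

Let alpha_gt0 : 0 < alpha. Proof. by case/andP: alpha01. Qed.

Definition negLn u : R := - pinv [set: R] ML u.

Lemma negLnP u : 0 < u <= 1 -> 0 <= negLn u /\ ML (- negLn u) = u.
Proof.
move=> u01; have [x x0 Mx] := ML_neg_surj alpha01 u01.
have K : ML (pinv [set: R] ML u) = u.
  by apply: pinvK; rewrite inE; exists (- x).
rewrite /negLn opprK; split => //; rewrite oppr_ge0 leNgt; apply/negP.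
move=> /(ML_gt1 alpha01); rewrite K; case/andP: u01 => _ u1.
by rewrite ltNge u1.
Qed.

Lemma negLn_upper u : 0 < u <= 1 -> kappa * negLn u <= u^-1 - 1.
Proof.
move=> u01; have [g0 gE] := negLnP u01; case/andP: (u01) => u0 u1.
have := ML_neg_upper alpha01 g0; rewrite gE mulrC -ler_pdivlMr// mul1r => H.
by rewrite lerBrDl mulrC.
Qed.

Lemma negLn_lower u : 0 < u <= 1 -> (1 - alpha) * (u^-1 - 1) <= negLn u.
Proof.
move=> u01; have [g0 gE] := negLnP u01; case/andP: (u01) => u0 u1.
have := ML_neg_lower alpha01 g0; rewrite gE -ler_pdivrMr//.
have -> : u^-1 - 1 = (1 - u) / u by rewrite mulrBl mul1r divff ?gt_eqF.
by rewrite mulrA.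
Qed.

Lemma negLn1 : negLn 1 = 0.
Proof.
have u01 : 0 < (1 : R) <= 1 by rewrite ltr01 lexx.
have [g0 _] := negLnP u01; have := negLn_upper u01.
rewrite invr1 subrr pmulr_rle0 ?ML_slope_gt0// => g1.
by apply/eqP; rewrite eq_le g1.
Qed.

(** [ML_neg_diff_lower] is a lower bound for the slope of the Mittag-Leffler function, hence
    an upper bound for that of its inverse; eliminating the argument by [negLn_upper]
    leaves a difference of reciprocals. *)
Lemma negLn_lipschitz w u : 0 < w -> w <= u -> u <= 1 ->
  0 <= kappa * (negLn w - negLn u) <= w^-1 - u^-1.
Proof.
move=> w0 wu u1; have k0 := ML_slope_gt0 alpha01.
have u0 := lt_le_trans w0 wu; have w1 := le_trans wu u1.
have w01 : 0 < w <= 1 by rewrite w0.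
have u01 : 0 < u <= 1 by rewrite u0.
have [gw0 gwE] := negLnP w01; have [gu0 guE] := negLnP u01.
have up := negLn_upper w01.
have [u1'|u1'] := eqVneq u 1.
  by rewrite u1' negLn1 subr0 invr1 up mulr_ge0// ltW.
have ult : u < 1 by rewrite lt_neqAle u1'.
have wlt := le_lt_trans wu ult.
have gg : negLn u <= negLn w.
  rewrite leNgt; apply/negP => /[dup] /ltW gle glt.
  have := ML_neg_diff_lower alpha01 gw0 gle; rewrite gwE guE => H.
  have : 0 < (negLn u - negLn w) * (w * (1 - u)).
    by rewrite !mulr_gt0// subr_gt0.
  move=> /lt_le_trans /(_ H); apply/negP; rewrite -leNgt.
  by rewrite mulr_ge0_le0// subr_le0.
rewrite pmulr_rge0// subr_ge0 gg/=.
have := ML_neg_diff_lower alpha01 gu0 gg; rewrite gwE guE => H.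
have D0 : 0 < u * (1 - w) by rewrite mulr_gt0// subr_gt0.
rewrite -(ler_pM2r D0) -mulrA; apply: le_trans (ler_wpM2l (ltW k0) H) _.
rewrite mulrA; apply: le_trans (ler_wpM2r _ up) _; first by rewrite subr_ge0.
have -> : (w^-1 - 1) * (u - w) = (w^-1 - u^-1) * (u * (1 - w)).
  by field; rewrite !gt_eqF.
by [].
Qed.

(** [negLn] in the variable [1 / u], in which it is Lipschitz on the whole line. *)
Definition negLn_inv (s : R) : R := negLn (Num.max s 1)^-1.

Lemma maxr1_inv (s : R) : 0 < (Num.max s 1)^-1 <= 1.
Proof.
have s1 : 1 <= Num.max s 1 by rewrite le_max lexx orbT.
by rewrite invr_gt0 (lt_le_trans ltr01 s1) invf_le1// (lt_le_trans ltr01 s1).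
Qed.

Lemma negLn_inv_ge0 (s : R) : 0 <= negLn_inv s.
Proof. by have [] := negLnP (maxr1_inv s). Qed.

Lemma negLn_inv_continuous : continuous negLn_inv.
Proof.
have k0 := ML_slope_gt0 alpha01.
have L s t : kappa * `|negLn_inv s - negLn_inv t| <= `|s - t|.
  wlog st : s t / s <= t => [H|].
    by have [/H//|/ltW/H] := leP s t; rewrite distrC [in X in _ -> X](distrC s).
  have s1 : 1 <= Num.max s 1 by rewrite le_max lexx orbT.
  have mm : Num.max s 1 <= Num.max t 1 by rewrite ge_max !le_max st lexx orbT.
  have s0 := lt_le_trans ltr01 s1; have t0 := lt_le_trans s0 mm.
  have ti0 : 0 < (Num.max t 1)^-1 by rewrite invr_gt0.
  have ts : (Num.max t 1)^-1 <= (Num.max s 1)^-1 by rewrite lef_pV2.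
  have si1 : (Num.max s 1)^-1 <= 1 by rewrite invf_le1.
  have /andP[] := negLn_lipschitz ti0 ts si1.
  rewrite !invrK -/(negLn_inv s) -/(negLn_inv t) pmulr_rge0// => d0 d1.
  rewrite distrC ger0_norm//; apply: le_trans d1 _.
  rewrite distrC ger0_norm ?subr_ge0//.
  have [hx|/ltW hx] := leP 1 s; rewrite ?(max_idPl hx) ?(max_idPr hx);
  have [hy|/ltW hy] := leP 1 t; rewrite ?(max_idPl hy) ?(max_idPr hy); lra.
move=> x; apply/cvgrPdist_le => /= e e0.
near=> y; rewrite -(ler_pM2l k0); apply: le_trans (L x y) _.
near: y; apply: cvgr_dist_le; first exact: cvg_id.
by rewrite mulr_gt0.
Unshelve. all: by end_near. Qed.

(** [u (- Ln u) ^ (1 / alpha)] on [(0, 1]]. The form chosen makes sense on the whole line,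
    where it is measurable, and is continuous at every positive [u]. *)
Definition efcpe_kernel u : R := u * negLn_inv (u `^ (-1)) `^ alpha^-1.

Lemma efcpe_kernelE u : 0 < u <= 1 -> efcpe_kernel u = u * negLn u `^ alpha^-1.
Proof.
move=> /andP[u0 u1]; rewrite /efcpe_kernel /negLn_inv.
by rewrite powR_inv1 ?ltW// (max_idPl _) ?invrK// invf_ge1.
Qed.

Lemma efcpe_kernel0 : efcpe_kernel 0 = 0.
Proof. by rewrite /efcpe_kernel mul0r. Qed.

Lemma efcpe_kernel_ge0 u : 0 <= u -> 0 <= efcpe_kernel u.
Proof. by move=> u0; rewrite mulr_ge0// powR_ge0. Qed.

Lemma efcpe_integrandE u : 0 <= u <= 1 ->
  (u%:E * (- Ln alpha u) `^ (alpha^-1)%R)%E = (efcpe_kernel u)%:E.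
Proof.
rewrite le_eqVlt => /andP[/predU1P[<-|u0] u1].
  by rewrite mul0e efcpe_kernel0.
rewrite efcpe_kernelE ?u0// /Ln gt_eqF//= EFinM; congr (_ * _)%E.
Qed.

Lemma efcpe_kernel_measurable : measurable_fun [set: R] efcpe_kernel.
Proof.
apply: measurable_funM => //.
apply: (measurableT_comp (@measurable_powR R alpha^-1)).
apply: measurableT_comp; first exact: continuous_measurable_fun negLn_inv_continuous.
exact: measurable_powR.
Qed.

Lemma powR_continuous_gt0 (r x : R) : 0 < x -> {for x, continuous (fun y : R => y `^ r)}.
Proof.
move=> x0; apply: differentiable_continuous; apply/derivable1_diffP.
by apply: derivable_powR; rewrite in_itv/= x0.
Qed.

Lemma powR_cvg_ge0 (I : Type) (F : set_system I) (z : I -> R) (l r : R) :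
  ProperFilter F -> 1 <= r -> (forall i, 0 <= z i) ->
  z i @[i --> F] --> l -> z i `^ r @[i --> F] --> l `^ r.
Proof.
move=> FF r1 z0 zl; have r0 := lt_le_trans ltr01 r1.
have l0 : 0 <= l.
  by rewrite -(cvg_lim _ zl)//; apply: limr_ge; [apply/cvg_ex; exists l|exact: nearW].
move: l0; rewrite le_eqVlt => /predU1P[l0|l0].
  rewrite -l0 in zl *; rewrite powR0 ?gt_eqF//.
  apply: (@squeeze_cvgr _ _ _ _ (fun=> 0) z) => //; last exact: cvg_cst.
  near=> i.
  rewrite powR_ge0/=; have zi1 : z i <= 1.
    by near: i; apply: cvgr_le zl _ ltr01.
  have [->|zi0] := eqVneq (z i) 0; first by rewrite powR0 ?gt_eqF.
  by apply: ge1r_powR => //; rewrite zi1 lt_neqAle eq_sym zi0 z0.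
exact: (cvg_comp _ _ zl (@powR_continuous_gt0 r l l0)).
Unshelve. all: by end_near. Qed.

Lemma efcpe_kernel_cvg (I : Type) (F : set_system I) (z : I -> R) u :
  ProperFilter F -> 0 < u ->
  z i @[i --> F] --> u -> efcpe_kernel (z i) @[i --> F] --> efcpe_kernel u.
Proof.
move=> FF u0 zu; case/andP: alpha01 => a0 a1.
apply: cvgM => //; apply: powR_cvg_ge0.
- by rewrite invf_ge1// ltW.
- by move=> i; exact: negLn_inv_ge0.
- apply: continuous_cvg; first exact: negLn_inv_continuous.
  exact: (cvg_comp _ _ zu (@powR_continuous_gt0 (-1) u u0)).
Qed.

Lemma powR_inv_split u : 0 < u ->
  u * (u^-1 - 1) `^ alpha^-1 = u `^ (1 - alpha^-1) * (1 - u) `^ alpha^-1 \/ 1 < u.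
Proof.
move=> u0; have [u1|] := leP u 1; [left|by right].
have -> : u^-1 - 1 = (1 - u) * u^-1 by rewrite mulrBl mul1r divff ?gt_eqF.
rewrite powRM ?subr_ge0 ?invr_ge0 ?(ltW u0)// mulrCA mulrC; congr (_ * _).
rewrite powRB ?(gt_eqF u0) ?implybT// powRr1 ?(ltW u0)//.
by rewrite -powR_inv1 ?(ltW u0)// -powRrM mulN1r powRN.
Qed.

Lemma efcpe_kernel_upper : exists2 C, 0 < C & forall u, 0 < u <= 1 ->
  efcpe_kernel u <= C * (u `^ (1 - alpha^-1) * (1 - u) `^ alpha^-1).
Proof.
have k0 := ML_slope_gt0 alpha01.
exists (kappa^-1 `^ alpha^-1) => [|u u01]; first by apply: powR_gt0; rewrite invr_gt0.
have [g0 _] := negLnP u01; have g1 := negLn_upper u01.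
rewrite efcpe_kernelE//; case/andP: u01 => u0 u1.
have [<-|] := powR_inv_split u0; last by rewrite ltNge u1.
have v0 : 0 <= u^-1 - 1 by rewrite subr_ge0 invf_ge1.
have ik0 : 0 <= kappa^-1 by rewrite invr_ge0 ltW.
rewrite mulrCA ler_wpM2l ?(ltW u0)// -powRM//.
apply: ge0_ler_powR; rewrite ?nnegrE ?invr_ge0 ?(ltW alpha_gt0)//.
  by rewrite mulr_ge0.
by rewrite mulrC ler_pdivlMr// mulrC.
Qed.

Lemma efcpe_kernel_lower : exists2 c, 0 < c & forall u, 0 < u <= 1 ->
  c * (u `^ (1 - alpha^-1) * (1 - u) `^ alpha^-1) <= efcpe_kernel u.
Proof.
have k0 : 0 < 1 - alpha by rewrite subr_gt0; case/andP: alpha01.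
exists ((1 - alpha) `^ alpha^-1) => [|u u01]; first exact: powR_gt0.
have [g0 _] := negLnP u01; have g1 := negLn_lower u01.
rewrite efcpe_kernelE//; case/andP: u01 => u0 u1.
have [<-|] := powR_inv_split u0; last by rewrite ltNge u1.
have v0 : 0 <= u^-1 - 1 by rewrite subr_ge0 invf_ge1.
rewrite mulrCA ler_wpM2l ?(ltW u0)// -powRM ?(ltW k0)//.
by apply: ge0_ler_powR; rewrite ?nnegrE ?mulr_ge0 ?invr_ge0 ?(ltW k0) ?(ltW alpha_gt0).
Qed.

End kernel.

(** * The empirical distribution function *)

Section empirical_cdf_count.
Context {R : realType}.
Implicit Types (s : seq R) (x : R).

Lemma empirical_cdfE s x : (0 < size s)%N ->
  empirical_cdf s x = (count (fun y => y <= x) s)%:R / (size s)%:R.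
Proof.
move=> s0; set t := sort <=%R s; set n := size s; set c := count _ s.
have tn : size t = n by rewrite size_sort.
have ts : sorted <=%R t by exact/sort_sorted/le_total.
have tc : count (fun y => y <= x) t = c by apply/permP; exact: permEl (perm_sort _ _).
have n0 : (n%:R : R) != 0 by rewrite pnatr_eq0 -lt0n.
have cn : (c <= n)%N by exact: count_size.
(* sortedness turns the count into a rank *)
have rank i : (i < n)%N -> (t`_i <= x) = (i < c)%N.
  move=> il; apply/idP/idP => [tx|ic]; last first.
    by apply: (@Order.PreorderTheory.nth_count_le _ _ x 0 t i ts); rewrite tc.
  rewrite -tc -(cat_take_drop i.+1 t) count_cat; apply: leq_trans (leq_addr _ _).
  have st : size (take i.+1 t) = i.+1 by rewrite size_takel// tn.
  rewrite -[X in (X <= _)%N]st; suff /eqP -> : count (<= x) (take i.+1 t) == size (take i.+1 t).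
    by [].
  rewrite -all_count; apply/(all_nthP 0) => j; rewrite st => ji.
  rewrite nth_take//; apply: le_trans tx.
  by apply: (sorted_leq_nth le_trans lexx 0 ts); rewrite ?inE ?tn//; lia.
rewrite /empirical_cdf /order_stat -/t -/n/=.
rewrite -/n in s0; clearbody c n.
rewrite ltNge (rank 0)// lt0n; case: eqP => [->|/eqP c0]/=; first by rewrite mul0r.
rewrite (rank n.-1) ?prednK//; case: ltnP => [cltn|nc]; last first.
  by rewrite (_ : c = n) ?divff//; lia.
rewrite (big_rem c)/=; last by rewrite mem_index_iota lt0n c0.
have cpos : (0 < c)%N by rewrite lt0n.
rewrite (rank c.-1); last by lia.
rewrite prednK// leqnn/= ltNge rank// ltnn/=.
rewrite big1_seq ?addr0// => k /andP[/andP[h1 h2]].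
rewrite rem_filter ?iota_uniq// mem_filter/= mem_index_iota => /and3P[kc k1 kn].
move: h1 h2; rewrite rank ?prednK//; last by lia.
rewrite ltNge rank// -leqNgt => h1 h2.
by move: kc; rewrite (_ : k = c) ?eqxx//; lia.
Qed.

End empirical_cdf_count.

(** * Independent events of equal probability *)

Section independent_events.
Context d (T : measurableType d) (R : realType) (P : probability T R).
Variables (A : nat -> set T) (u : R).
Hypothesis mA : forall i, measurable (A i).
Hypothesis PA : forall i, P (A i) = u%:E.
Hypothesis indepA : forall J : {fset nat},
  P (\bigcap_(i in [set` J]) A i) = (\prod_(i <- J) P (A i))%E.
Implicit Types (m i j : nat) (J : {fset nat}).

Local Notation I i := (\1_(A i) : T -> R).
Local Notation N m := (fun w => \sum_(i < m) I i w).

Lemma integrable_bounded (f : T -> R) (M : R) :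
  measurable_fun setT f -> (forall w, `|f w| <= M) ->
  P.-integrable setT (EFin \o f).
Proof.
move=> mf fM; apply: measurable_bounded_integrable => //.
  exact: le_lt_trans (probability_le1 P measurableT) (ltry 1).
exists M; split; first by rewrite num_real.
by move=> K MK w _; apply: le_trans (fM w) (ltW MK).
Qed.

Lemma prob_ge0 : 0 <= u.
Proof. by rewrite -lee_fin -(PA 0%N). Qed.

Lemma prob_le1 : u <= 1.
Proof. by rewrite -lee_fin -(PA 0%N) probability_le1. Qed.

Lemma prob_bigcap J : P (\bigcap_(i in [set` J]) A i) = (u ^+ #|` J|)%:E.
Proof.
rewrite indepA (eq_bigr (fun=> u%:E)) => [|i _]; last exact: PA.
rewrite big_const_seq count_predT -[size J]/(#|` J|).
by elim: #|` J| => [|k IH]; rewrite ?expr0//= IH exprS EFinM.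
Qed.

Lemma measurable_bigcapJ J : measurable (\bigcap_(i in [set` J]) A i).
Proof. by apply: fin_bigcap_measurable. Qed.

Lemma indic_measurable i : measurable_fun setT (I i).
Proof. exact: measurable_indic. Qed.

Lemma count_measurable m : measurable_fun setT (N m).
Proof. by apply: measurable_sum => i; exact: indic_measurable. Qed.

Local Notation half m := (fun w => \prod_(i < m) (1 - 2^-1 * I i w)).

Lemma indic01 i w : 0 <= I i w <= 1.
Proof. by rewrite indicE; case: (_ \in _); rewrite lexx ler01. Qed.

Lemma half01 m w : 0 <= half m w <= 1.
Proof.
elim: m => [|m /andP[h0 h1]]; first by rewrite big_ord0 lexx ler01.
rewrite big_ord_recr/=; have /andP[i0 i1] := indic01 m w.
have g0 : 0 <= 1 - 2^-1 * I m w by lra.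
have g1 : 1 - 2^-1 * I m w <= 1 by lra.
by rewrite mulr_ge0//= -[leRHS]mulr1 ler_pM.
Qed.

Lemma half_measurable m : measurable_fun setT (half m).
Proof.
apply: measurable_prod => i _; apply: measurable_funB => //.
by apply: measurable_funM => //; exact: indic_measurable.
Qed.

(** Product rule for [E (1/2)^N], by peeling factors off: expanding the last factor either
    drops it or moves the index [m] into [J]. *)
Lemma expectation_half m J : (forall j, j \in J -> (m <= j)%N) ->
  \int[P]_w (half m w * \1_(\bigcap_(i in [set` J]) A i) w) =
  (1 - 2^-1 * u) ^+ m * u ^+ #|` J|.
Proof.
elim: m J => [|m IH] J mJ.
  under eq_Rintegral do rewrite big_ord0 mul1r.
  rewrite expr0 mul1r /Rintegral integral_indic ?setIT//; last exact: measurable_bigcapJ.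
  exact: (congr1 fine (prob_bigcap J)).
have mnJ : m \notin J by apply/negP => /mJ; rewrite ltnn.
transitivity (\int[P]_w
   (half m w * \1_(\bigcap_(i in [set` J]) A i) w -
    2^-1 * (half m w * \1_(\bigcap_(i in [set` (m |` J)%fset]) A i) w))).
  apply: eq_Rintegral => w _; rewrite big_ord_recr/= set_fsetU set_fset1.
  rewrite bigcap_setU bigcap_set1 indicI /=; ring.
have int (K : {fset nat}) : P.-integrable setT
    (EFin \o (fun w => half m w * \1_(\bigcap_(i in [set` K]) A i) w)).
  apply: (@integrable_bounded _ 1).
    apply: measurable_funM; first exact: half_measurable.
    apply: measurable_indic; exact: measurable_bigcapJ.
  move=> w; have /andP[h0 h1] := half01 m w.
  rewrite ger0_norm ?mulr_ge0// indicE; case: (_ \in _); rewrite ?mulr1 ?mulr0//.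
rewrite RintegralB//=; last exact: (integrableZl _ 2^-1 (int _)).
rewrite RintegralZl// IH ?IH; last 2 first.
- by move=> j; rewrite !inE => /predU1P[->//|/mJ/ltnW].
- by move=> j /mJ/ltnW.
by rewrite cardfsU1 mnJ/= add1n !exprS; ring.
Qed.

(** Chernoff's bound for the lower tail, with the weight [(1/2)^N >= exp (- N)]. *)
Lemma chernoff_lower m :
  (P [set w | (N m w < m%:R * u / 4)%R] <= (expR (- (m%:R * u / 4)))%:E)%E.
Proof.
set t := m%:R * u / 4; set B := [set w | _].
have mB : measurable B.
  have mf : measurable_fun setT (fun w => N m w < t).
    by apply: measurable_fun_ltr => //; exact: count_measurable.
  have := mf measurableT [set true] (Logic.I : measurable [set true]).
  by congr measurable; apply/seteqP; split => w //= -[].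
have halfN k w : expR (- N k w) <= half k w.
  elim: k => [|k IH]; first by rewrite !big_ord0 oppr0 expR0.
  rewrite !big_ord_recr/= opprD expRD; apply: ler_pM; rewrite ?expR_ge0//.
  rewrite indicE; case: (_ \in _); last by rewrite oppr0 expR0 mulr0 subr0.
  rewrite mulr1 expRN (_ : 1 - 2^-1 = 2^-1); last by lra.
  rewrite lef_pV2 ?posrE ?expR_gt0//.
  by apply: le_trans (expR_ge1Dx 1).
have hE : \int[P]_w half m w = (1 - 2^-1 * u) ^+ m.
  have := @expectation_half m fset0; rewrite cardfs0 expr0 mulr1 => <- //.
  by apply: eq_Rintegral => w _; rewrite set_fset0 bigcap_set0 indicT mulr1.
have hle : (1 - 2^-1 * u) ^+ m <= expR (- t) * expR (- t).
  have -> : expR (- t) * expR (- t) = expR (- (2^-1 * u)) ^+ m.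
    by rewrite -expRD -expRM_natl; congr expR; rewrite /t; field.
  have ? := prob_le1; apply: lerXn2r; rewrite ?nnegrE ?expR_ge0//; last exact: onem_exp_le.
  by have := prob_ge0; lra.
have : expR (- t) * fine (P B) <= expR (- t) * expR (- t).
  apply: le_trans hle; rewrite -hE.
  have -> : expR (- t) * fine (P B) = \int[P]_w (expR (- t) * \1_B w).
    rewrite RintegralZl//; last first.
      apply: (@integrable_bounded _ 1); first exact: measurable_indic.
      by move=> w; rewrite indicE; case: (_ \in _); rewrite ?normr0 ?normr1.
    by rewrite /Rintegral integral_indic ?setIT.
  apply: le_Rintegral => //.
  - apply: (@integrable_bounded _ (expR (- t))).
      by apply: measurable_funM => //; exact: measurable_indic.
    move=> w; rewrite ger0_norm ?mulr_ge0 ?expR_ge0//.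
    by rewrite indicE; case: (_ \in _); rewrite ?mulr1 ?mulr0 ?expR_ge0.
  - apply: (@integrable_bounded _ 1); first exact: half_measurable.
    by move=> w; have /andP[h0 h1] := half01 m w; rewrite ger0_norm.
  - move=> w _; have /andP[h0 h1] := half01 m w.
    rewrite indicE; case: (boolP (w \in B)) => [|_]; last by rewrite mulr0.
    rewrite inE /B/= mulr1 => wB; apply: le_trans (halfN m w).
    by rewrite ler_expR lerN2 ltW.
rewrite ler_pM2l ?expR_gt0// -lee_fin fineK//.
exact: fin_num_measure.
Qed.

Definition bounded_mfun (f : T -> R) :=
  measurable_fun setT f /\ exists M, forall w, `|f w| <= M.

Lemma bounded_mfun_integrable f : bounded_mfun f -> P.-integrable setT (EFin \o f).
Proof. by move=> [mf [M fM]]; exact: integrable_bounded fM. Qed.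

Lemma bounded_mfun_cst c : bounded_mfun (fun=> c).
Proof. by split => //; exists `|c|. Qed.

Lemma bounded_mfunD f g : bounded_mfun f -> bounded_mfun g ->
  bounded_mfun (fun w => f w + g w).
Proof.
move=> [mf [M fM]] [mg [K gK]]; split; first exact: measurable_funD.
exists (M + K) => w; exact: le_trans (ler_normD _ _) (lerD (fM w) (gK w)).
Qed.

Lemma bounded_mfunM f g : bounded_mfun f -> bounded_mfun g ->
  bounded_mfun (fun w => f w * g w).
Proof.
move=> [mf [M fM]] [mg [K gK]]; split; first exact: measurable_funM.
by exists (M * K) => w; rewrite normrM ler_pM.
Qed.

Lemma bounded_mfun_indic (B : set T) : measurable B -> bounded_mfun (\1_B).
Proof.
move=> mB; split; first exact: measurable_indic.
by exists 1 => w; rewrite indicE; case: (_ \in _); rewrite ?normr0 ?normr1.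
Qed.

Lemma bounded_mfun_count m : bounded_mfun (N m).
Proof.
elim: m => [|m IH].
  by under eq_fun do rewrite big_ord0; exact: bounded_mfun_cst.
under eq_fun do rewrite big_ord_recr/=.
by apply: bounded_mfunD IH _; exact: bounded_mfun_indic.
Qed.

Lemma RintegralDb f g : bounded_mfun f -> bounded_mfun g ->
  \int[P]_w (f w + g w) = \int[P]_w f w + \int[P]_w g w.
Proof. by move=> bf bg; rewrite RintegralD//; exact: bounded_mfun_integrable. Qed.

Lemma RintegralZb c f : bounded_mfun f ->
  \int[P]_w (c * f w) = c * \int[P]_w f w.
Proof. by move=> bf; rewrite RintegralZl//; exact: bounded_mfun_integrable. Qed.

Lemma Rintegral_cstP c : \int[P]_w c = c.
Proof. by rewrite Rintegral_cst// [fine _](congr1 fine (probability_setT P)) mulr1. Qed.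

Lemma Rintegral_indicA i : \int[P]_w I i w = u.
Proof. by rewrite /Rintegral integral_indic ?setIT//; exact: (congr1 fine (PA i)). Qed.

Lemma Rintegral_indicM i j : i != j -> \int[P]_w (I i w * I j w) = u ^+ 2.
Proof.
move=> ij; transitivity (\int[P]_w (\1_(\bigcap_(k in [set` [fset i; j]%fset]) A k) w)).
  apply: eq_Rintegral => w _.
  by rewrite set_fsetU !set_fset1 bigcap_setU !bigcap_set1 indicI.
rewrite /Rintegral integral_indic ?setIT//; last exact: measurable_bigcapJ.
by rewrite [LHS](congr1 fine (prob_bigcap _)) cardfs2 ij.
Qed.

Lemma covariance_count m j : (m <= j)%N ->
  \int[P]_w (N m w * I j w) = m%:R * u ^+ 2.
Proof.
have bI i := bounded_mfun_indic (mA i).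
elim: m => [|m IH] mj.
  by under eq_Rintegral do rewrite big_ord0 mul0r; rewrite Rintegral_cstP mul0r.
under eq_Rintegral do rewrite big_ord_recr/= mulrDl.
rewrite RintegralDb ?IH ?(ltnW mj)//.
- by rewrite Rintegral_indicM -?natr1 ?mulrDl ?mul1r// ltn_eqF.
- by apply: bounded_mfunM => //; exact: bounded_mfun_count.
- exact: bounded_mfunM.
Qed.

Lemma expectation_count m : \int[P]_w N m w = m%:R * u.
Proof.
elim: m => [|m IH].
  by under eq_Rintegral do rewrite big_ord0; rewrite Rintegral_cstP mul0r.
under eq_Rintegral do rewrite big_ord_recr/=.
rewrite RintegralDb ?IH ?Rintegral_indicA//.
- by rewrite -natr1 mulrDl mul1r.
- exact: bounded_mfun_count.
- exact: bounded_mfun_indic.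
Qed.

Lemma expectation_count2 m :
  \int[P]_w (N m w ^+ 2) = m%:R * u * (1 - u) + (m%:R * u) ^+ 2.
Proof.
have bI i := bounded_mfun_indic (mA i); have bN := bounded_mfun_count.
have bNI k := bounded_mfunM (bN k) (bI k).
elim: m => [|m IH].
  under eq_Rintegral do rewrite big_ord0 expr0n/=; rewrite Rintegral_cstP; ring.
transitivity (\int[P]_w (N m w ^+ 2 + (2 * (N m w * I m w) + I m w))).
  apply: eq_Rintegral => w _; rewrite big_ord_recr/= sqrrD -addrA; congr (_ + _).
  rewrite mulr_natl; congr (_ + _).
  by rewrite indicE; case: (_ \in _); rewrite ?expr1n// expr0n.
rewrite RintegralDb; last 2 first.
- exact: (bounded_mfunM (bN m) (bN m)).
- apply: bounded_mfunD (bI m).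
  exact: bounded_mfunM (bounded_mfun_cst 2) (bNI m).
rewrite RintegralDb; last 2 first.
- exact: bounded_mfunM (bounded_mfun_cst 2) (bNI m).
- exact: bI.
rewrite IH RintegralZb ?covariance_count ?Rintegral_indicA//.
by rewrite -natr1; ring.
Qed.

Lemma variance_mean m : (0 < m)%N ->
  (\int[P]_w (((N m w / m%:R - u) ^+ 2)%R)%:E = (u * (1 - u) / m%:R)%:E)%E.
Proof.
move=> m0; have bN := bounded_mfun_count m.
have mn0 : m%:R != 0 :> R by rewrite pnatr_eq0 -lt0n.
have bc c := bounded_mfun_cst c.
have b1 : bounded_mfun (fun w => N m w ^+ 2) by exact: bounded_mfunM.
have b2 : bounded_mfun (fun w => m%:R^-1 ^+ 2 * N m w ^+ 2) by exact: bounded_mfunM.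
have b3 : bounded_mfun (fun w => - (2 * u / m%:R) * N m w) by exact: bounded_mfunM.
have b4 := bounded_mfunD b3 (bc (u ^+ 2)).
have b5 : bounded_mfun (fun w => (N m w / m%:R - u) ^+ 2).
  have b6 : bounded_mfun (fun w => N m w / m%:R - u).
    by apply: bounded_mfunD (bc (- u)); exact: bounded_mfunM (bc _).
  exact: (bounded_mfunM b6 b6).
rewrite -[LHS]fineK; last exact: integrable_fin_num (bounded_mfun_integrable b5).
congr EFin; transitivity (\int[P]_w
    (m%:R^-1 ^+ 2 * N m w ^+ 2 + (- (2 * u / m%:R) * N m w + u ^+ 2))).
  apply: eq_Rintegral => w _; by move: (N m w) => n; field.
have /= e1 := RintegralDb b2 b4; have /= e2 := RintegralDb b3 (bc (u ^+ 2)).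
have /= e3 := RintegralZb (m%:R^-1 ^+ 2) b1.
have /= e4 := RintegralZb (- (2 * u / m%:R)) bN.
rewrite e1 e2 e3 e4.
by rewrite expectation_count expectation_count2 Rintegral_cstP; field.
Qed.

End independent_events.

(** * Frequencies along subsequences *)

Section frequencies.
Context {R : realType} (b : nat -> bool).
Implicit Types (n m k : nat) (u g r : R).

Definition freq n : R := (\sum_(i < n) (b i)%:R) / n%:R.

Local Notation N n := (\sum_(i < n) (b i)%:R : R).

Lemma hits_ge0 n : 0 <= N n.
Proof. exact: sumr_ge0. Qed.

Lemma hits_le m n : (m <= n)%N -> 0 <= N n - N m <= (n - m)%N%:R.
Proof.
move=> mn; rewrite -(subnKC mn) big_split_ord/= addrAC subrr add0r addKn.
rewrite sumr_ge0//=; apply: le_trans (_ : \sum_(i < n - m) 1 <= _).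
  by apply: ler_sum => i _; rewrite -[leRHS]/(1%:R) ler_nat leq_b1.
by rewrite sumr_const card_ord.
Qed.

Lemma hits_nat n : exists k, N n = k%:R.
Proof. by exists (\sum_(i < n) b i)%N; rewrite natr_sum. Qed.

Lemma freq01 n : 0 <= freq n <= 1.
Proof.
rewrite /freq; case: n => [|n]; first by rewrite big_ord0 mul0r lexx ler01.
rewrite divr_ge0 ?hits_ge0//= ler_pdivrMr// mul1r.
by have /andP[_] := hits_le (leq0n n.+1); rewrite big_ord0 subr0 subn0.
Qed.

Lemma freqK n : (0 < n)%N -> freq n * n%:R = N n.
Proof. by move=> n0; rewrite /freq divfK// pnatr_eq0 -lt0n. Qed.

(** If the frequency at the dyadic time below [n] is comparable to [u], it still is at
    time [n]; otherwise the trivial bound [n] for the inverse frequency is used. *)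
Lemma freq_dyadic_lower g u n i : 0 < g -> 0 < u ->
  (2 ^ i <= n < 2 ^ i.+1)%N ->
  freq n `^ (- g) <= 8 `^ g * u `^ (- g) +
    (2 `^ g) ^+ i.+1 * (N (2 ^ i)%N < (2 ^ i)%N%:R * u / 4)%R%:R.
Proof.
move=> g0 u0 /andP[im nM]; have m0 : (0 < 2 ^ i)%N by rewrite expn_gt0.
have n0 : (0 < n)%N by exact: leq_trans im.
have m0R : 0 < (2 ^ i)%N%:R :> R by rewrite ltr0n.
have n0R : 0 < n%:R :> R by rewrite ltr0n.
have nM' : n%:R <= 2 * (2 ^ i)%N%:R :> R.
  by rewrite -natrM ler_nat -expnS ltnW.
have NN : N (2 ^ i)%N <= N n by have /andP[] := hits_le im; rewrite subr_ge0.
have X0 : 0 <= 8 `^ g * u `^ (- g) by rewrite mulr_ge0 ?powR_ge0.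
have anti (x y : R) : 0 < x -> x <= y -> y `^ (- g) <= x `^ (- g).
  move=> x0 xy; rewrite !powRN lef_pV2 ?posrE ?powR_gt0 ?(lt_le_trans x0)//.
  by apply: ge0_ler_powR; rewrite ?nnegrE ?(ltW g0) ?(ltW x0) ?(le_trans (ltW x0)).
case: ltP => [_|H]; last first.
  rewrite mulr0 addr0; apply: le_trans (anti (u / 8) _ _ _) _.
  - by rewrite divr_gt0.
  - rewrite /freq ler_pdivlMr//; apply: le_trans NN; apply: le_trans H.
    apply: le_trans (_ : u / 8 * (2 * (2 ^ i)%N%:R) <= _); first by rewrite ler_pM2l// divr_gt0.
    by move: (2 ^ i)%N%:R => q; rewrite (_ : _ * _ = q * u / 4) ?lexx//; field.
  - rewrite powRM ?(ltW u0)// -[8^-1]powR_inv1// -powRrM mulN1r opprK.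
    by rewrite mulrC.
rewrite mulr1; apply: le_trans (_ : (2 `^ g) ^+ i.+1 <= _); last by rewrite lerDr.
have [k Nk] := hits_nat n.
have [k0|k0] := posnP k.
  by rewrite /freq Nk k0 mul0r powR0 ?oppr_eq0 ?gt_eqF// exprn_ge0// powR_ge0.
have f0 : n%:R^-1 <= freq n.
  by rewrite /freq Nk ler_peMl ?invr_ge0// ler1n.
apply: le_trans (anti _ _ _ f0) _; first by rewrite invr_gt0.
rewrite -powR_inv1// -powRrM mulrN mulN1r opprK -powR_mulrn ?powR_ge0// -powRrM mulrC powRrM.
apply: ge0_ler_powR; rewrite ?nnegrE ?powR_ge0 ?(ltW g0)//.
by rewrite powR_mulrn// -natrX ler_nat ltnW.
Qed.

(** With [c] and [v] the upper frequencies at time [m = 2 ^ i.+1] and in the limit, either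
    [c <= 2 v], or [c] is at most twice the deviation [c - v]; in the second case
    [c >= 1 / m] trades the power [r] for a square. *)
Lemma freq_dyadic_upper r u n i : 1 <= r <= 2 -> 0 <= u <= 1 ->
  (2 ^ i <= n < 2 ^ i.+1)%N ->
  (1 - freq n) `^ r <= 16 * (1 - u) +
    16 * ((2 ^ i.+1)%N%:R `^ (2 - r) * (freq (2 ^ i.+1)%N - u) ^+ 2).
Proof.
move=> /andP[r1 r2] /andP[u0 u1] /andP[im nM]; set m := (2 ^ i.+1)%N.
have r0 : 0 < r by lra.
have n0 : (0 < n)%N by apply: leq_trans im; rewrite expn_gt0.
have m0 : (0 < m)%N by rewrite expn_gt0.
have n0R : 0 < n%:R :> R by rewrite ltr0n.
have m0R : 0 < m%:R :> R by rewrite ltr0n.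
have mn : m%:R <= 2 * n%:R :> R by rewrite -natrM ler_nat /m expnS leq_mul2l im orbT.
pose c := 1 - freq m; pose v := 1 - u.
have c01 : 0 <= c <= 1 by have := freq01 m; rewrite /c; lra.
have v0 : 0 <= v by rewrite /v; lra.
have /andP[c0 c1] := c01.
have fn : 1 - freq n <= 2 * c.
  have := hits_le (ltnW nM); rewrite -/m natrB 1?ltnW// => /andP[_ H].
  rewrite -(ler_pM2r n0R) mulrBl mul1r freqK//.
  apply: le_trans (_ : c * m%:R <= _).
    by rewrite /c mulrBl mul1r freqK//; lra.
  by rewrite (_ : 2 * c * n%:R = c * (2 * n%:R)) ?ler_wpM2l//; ring.
have fn0 : 0 <= 1 - freq n by have := freq01 n; lra.
have powle : (1 - freq n) `^ r <= 4 * c `^ r.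
  apply: le_trans (_ : (2 * c) `^ r <= _).
    by apply: ge0_ler_powR; rewrite ?nnegrE ?mulr_ge0 ?(ltW r0).
  rewrite powRM// ler_wpM2r ?powR_ge0//.
  apply: le_trans (_ : 2 `^ 2%:R <= _); first by apply: ler_powR => //; lra.
  by rewrite powR_mulrn//; lra.
apply: le_trans powle _; rewrite -/v.
have -> : (freq m - u) ^+ 2 = (c - v) ^+ 2 by rewrite /c /v; ring.
have p0 : 0 <= m%:R `^ (2 - r) * (c - v) ^+ 2 by rewrite mulr_ge0 ?powR_ge0 ?sqr_ge0.
have [cv|cv] := leP c (2 * v).
  have : c `^ r <= c.
    have [->|cn0] := eqVneq c 0; first by rewrite powR0 ?gt_eqF.
    have cgt0 : 0 < c by rewrite lt_neqAle eq_sym cn0.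
    by apply: ge1r_powR => //; rewrite cgt0.
  by move: (c `^ r) (_ * _) p0 cv v0 => A B; lra.
have cpos : 0 < c by lra.
have cm : m%:R^-1 <= c.
  have [k Nk] := hits_nat m.
  have cE : c = (m - k)%N%:R / m%:R.
    have km : (k <= m)%N.
      by have := freq01 m; rewrite /freq Nk ler_pdivrMr// mul1r ler_nat => /andP[].
    by rewrite natrB// mulrBl divff ?gt_eqF// -Nk.
  move: cpos; rewrite cE pmulr_lgt0 ?invr_gt0// ltr0n => k0.
  by rewrite ler_peMl ?invr_ge0 ?(ltW m0R)// ler1n.
have : c `^ r <= m%:R `^ (2 - r) * (4 * (c - v) ^+ 2).
  have -> : c `^ r = c^-1 `^ (2 - r) * c ^+ 2.
    rewrite -powR_inv1 ?(ltW cpos)// -powRrM -powR_mulrn// -powRD.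
      by congr (_ `^ _); lra.
    by rewrite (gt_eqF cpos) implybT.
  apply: ler_pM; rewrite ?powR_ge0 ?sqr_ge0//.
    apply: ge0_ler_powR; rewrite ?nnegrE ?invr_ge0 ?(ltW m0R)//; first lra.
    by rewrite -[leRHS]invrK lef_pV2 ?posrE ?invr_gt0.
  have -> : 4 * (c - v) ^+ 2 = (2 * (c - v)) ^+ 2 by ring.
  by apply: lerXn2r; rewrite ?nnegrE; lra.
rewrite mulrCA; move: (c `^ r) (_ * _) p0 v0 => A B; lra.
Qed.

Lemma freq_dist m n : (0 < m)%N -> (m <= n)%N ->
  `|freq n - freq m| <= (n - m)%N%:R / n%:R.
Proof.
move=> m0 mn; have n0 := leq_trans m0 mn.
have m0R : 0 < m%:R :> R by rewrite ltr0n.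
have n0R : 0 < n%:R :> R by rewrite ltr0n.
have /andP[h0 h1] := hits_le mn.
have /andP[f0 f1] := freq01 m.
have E : (freq n - freq m) * n%:R = (N n - N m) - freq m * (n - m)%N%:R.
  by rewrite mulrBl freqK// natrB// mulrBr freqK//; ring.
rewrite ler_pdivlMr// -[n%:R]gtr0_norm// -normrM E ler_norml.
rewrite natrB// in h1 *.
have nm0 : 0 <= n%:R - m%:R :> R by rewrite subr_ge0 ler_nat.
have fm : freq m * (n%:R - m%:R) <= n%:R - m%:R by rewrite ler_piMl.
have fm0 : 0 <= freq m * (n%:R - m%:R) by rewrite mulr_ge0.
by lra.
Qed.

Lemma between_squares n : (0 < n)%N -> exists k, (k.+1 ^ 2 <= n < k.+2 ^ 2)%N.
Proof.
elim: n => // -[_ _|n IH _]; first by exists 0%N.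
have [//|k /andP[h1 h2]] := IH.
have [h|h] := ltnP n.+2 (k.+2 ^ 2); first by exists k; rewrite h (leq_trans h1).
exists k.+1; rewrite h/=; apply: leq_trans (_ : (k.+2 ^ 2).+1 <= _)%N; first by [].
by rewrite -!mulnn; lia.
Qed.

(** Convergence along the squares suffices, since the frequency moves by at most [2 / k]
    between consecutive squares. *)
Lemma freq_cvg_squares u :
  freq (k.+1 ^ 2)%N @[k --> \oo] --> u -> freq n @[n --> \oo] --> u.
Proof.
move=> H; apply/cvgrPdist_le => /= e e0.
have e2 : 0 < e / 2 by rewrite divr_gt0.
have : \forall k \near \oo, `|u - freq (k.+1 ^ 2)%N| <= e / 2 /\ 2 / k.+1%:R <= e / 2.
  near=> k; split; near: k; first by move/cvgrPdist_le : H; exact.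
  near=> k; rewrite ler_pdivrMr// -ler_pdivrMl//.
  by apply: le_trans (_ : k%:R <= _); [near: k; exact: nbhs_infty_ger|rewrite ler_nat].
move=> [K _ HK]; near=> n.
have Kn : (K.+1 ^ 2 <= n)%N by near: n; exact: nbhs_infty_ge.
have n0 : (0 < n)%N by apply: leq_trans Kn; rewrite expn_gt0.
have [k /andP[h1 h2]] := between_squares n0.
have Kk : (K <= k)%N.
  rewrite leqNgt; apply/negP => kK.
  have H2 : (k.+2 ^ 2 <= K.+1 ^ 2)%N by rewrite leq_exp2r.
  by have := leq_trans h2 (leq_trans H2 Kn); rewrite ltnn.
have [d1 d2] := HK k Kk.
have -> : u - freq n = (u - freq (k.+1 ^ 2)%N) - (freq n - freq (k.+1 ^ 2)%N) by ring.
apply: le_trans (ler_normB _ _) _; rewrite [leRHS](splitr e) lerD//.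
apply: le_trans (freq_dist _ h1) _; first by rewrite expn_gt0.
apply: le_trans d2; rewrite ler_pdivrMr ?ltr0n//.
have k0R : 0 < k.+1%:R :> R by [].
apply: le_trans (_ : 2 / k.+1%:R * (k.+1 ^ 2)%N%:R <= _); last first.
  by rewrite ler_wpM2l ?divr_ge0// ler_nat.
rewrite natrX expr2 mulrA divfK ?gt_eqF// -natrM ler_nat.
by move: h2; rewrite -!mulnn; lia.
Unshelve. all: by end_near. Qed.

End frequencies.

(** * A dyadic exponential sum *)

Section dyadic_sum.
Context {R : realType}.
Implicit Types (g u w : R).

(** With [w = 2 ^ i u] and [y = w ^ g], the summand times [u ^ g] is at most a constant
    times the increment of [y / (1 + y)] over one dyadic step, so that the sum
    telescopes. *)
Lemma dyadic_exp_sum g : 0 < g -> exists2 C : R, 0 < C & forall u n, 0 < u ->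
  \sum_(i < n) (2 `^ g) ^+ i * expR (- (2 ^+ i * u / 4)) <= C * u `^ (- g).
Proof.
move=> g0; pose a : R := 2 `^ g.
have a1 : 1 < a.
  rewrite -(powRr0 (2 : R)) /a; rewrite /powR; case: eqP => [|_]; first by lra.
  by rewrite mul0r ltr_expR mulr_gt0// ln_gt0// ltr1n.
pose C1 : R := 1 + ((g + 1) / 8^-1) `^ g.
have C10 : 0 < C1 by rewrite ltr_pwDl// powR_ge0.
pose K := C1 ^+ 2 * (a / (a - 1)).
have K0 : 0 < K by rewrite mulr_gt0 ?exprn_gt0// divr_gt0//; lra.
pose psi (y : R) := y / (1 + y).
have key w : 0 < w ->
    w `^ g * expR (- (w / 4)) <= K * (psi (a * w `^ g) - psi (w `^ g)).
  move=> w0; set y := w `^ g; have y0 : 0 < y by exact: powR_gt0.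
  have h : (1 + y) ^+ 2 <= C1 ^+ 2 * expR (w / 4).
    have -> : expR (w / 4) = expR (8^-1 * w) ^+ 2.
      by rewrite -expRM_natl; congr expR; lra.
    rewrite -exprMn; apply: lerXn2r; rewrite ?nnegrE ?mulr_ge0 ?expR_ge0 ?(ltW C10)//.
      by rewrite addr_ge0// ltW.
    rewrite /C1 mulrDl mul1r; apply: lerD.
      by rewrite -expR0 ler_expR mulr_ge0// ltW.
    by apply: powR_le_expR => //; rewrite ?(ltW g0)// invr_gt0.
  have -> : psi (a * y) - psi y = (a - 1) * y / ((1 + a * y) * (1 + y)).
    have ay0 : 0 < a * y by rewrite mulr_gt0//; lra.
    by rewrite /psi; field; rewrite !gt_eqF//; lra.
  rewrite expRN ler_pdivrMr ?expR_gt0//.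
  have d0 : 0 < (1 + a * y) * (1 + y).
    by rewrite !mulr_gt0// ?ltr_pwDl// ?mulr_ge0 ?(ltW y0)//; lra.
  rewrite -(ler_pM2r d0).
  have -> : K * ((a - 1) * y / ((1 + a * y) * (1 + y))) * expR (w / 4) *
      ((1 + a * y) * (1 + y)) = y * (a * (C1 ^+ 2 * expR (w / 4))).
    have ay0 : 0 < a * y by rewrite mulr_gt0//; lra.
    by rewrite /K; field; rewrite !gt_eqF//; lra.
  rewrite ler_pM2l//; apply: le_trans (_ : a * (1 + y) ^+ 2 <= _).
    rewrite expr2 mulrA ler_wpM2r//; first by lra.
    by rewrite mulrDr mulr1 lerD2r ltW.
  by rewrite ler_wpM2l//; lra.
exists K => // u n u0.
have term i : a ^+ i * expR (- (2 ^+ i * u / 4)) <= K * u `^ (- g) *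
    (psi (a ^+ i.+1 * u `^ g) - psi (a ^+ i * u `^ g)).
  have w0 : 0 < 2 ^+ i * u by rewrite mulr_gt0// exprn_gt0.
  have wg : (2 ^+ i * u) `^ g = a ^+ i * u `^ g.
    rewrite powRM ?exprn_ge0 ?(ltW u0)//; congr (_ * _).
    by rewrite -powR_mulrn// -powRrM mulrC powRrM powR_mulrn ?powR_ge0.
  have ug0 : 0 < u `^ g by exact: powR_gt0.
  have := key _ w0; rewrite wg mulrA -exprS => H.
  by rewrite powRN [leRHS]mulrAC ler_pdivlMr// [leLHS]mulrAC.
have tele : \sum_(i < n) a ^+ i * expR (- (2 ^+ i * u / 4)) <= K * u `^ (- g) *
    (psi (a ^+ n * u `^ g) - psi (a ^+ 0 * u `^ g)).
  elim: n => [|n IH]; first by rewrite big_ord0 subrr mulr0.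
  rewrite big_ord_recr/=; apply: le_trans (lerD IH (term n)) _.
  by rewrite -mulrDr addrC addrA subrK.
have KU : 0 <= K * u `^ (- g) by apply: mulr_ge0 (ltW K0) (powR_ge0 _ _).
apply: le_trans tele _; rewrite ler_piMr//.
have psi01 (y : R) : 0 <= y -> 0 <= psi y <= 1.
  move=> y0; have y1 : 0 < 1 + y by rewrite ltr_pwDl.
  by rewrite divr_ge0 ?(ltW y1)//= ler_pdivrMr// mul1r lerDr.
have p k : 0 <= a ^+ k * u `^ g by rewrite mulr_ge0 ?powR_ge0// exprn_ge0//; lra.
by have := psi01 _ (p n); have := psi01 _ (p 0%N); lra.
Qed.

End dyadic_sum.

(** * Integrable majorants of the empirical distribution function *)

Section nonnegative_series.
Context {R : realType}.
Local Open Scope ereal_scope.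

Lemma nneseries_le_partial (v : nat -> R) (B : R) : (forall i, 0 <= v i)%R ->
  (forall n, \sum_(i < n) v i <= B)%R -> \sum_(0 <= i <oo) (v i)%:E <= B%:E.
Proof.
move=> v0 vB; apply: lime_le.
  by apply: is_cvg_nneseries => i _ _; rewrite lee_fin.
by apply: nearW => n; rewrite sumEFin lee_fin big_mkord.
Qed.

Lemma nneseries_term_le (v : nat -> \bar R) (k : nat) : (forall i, 0 <= v i) ->
  v k <= \sum_(0 <= i <oo) v i.
Proof.
move=> v0; apply: le_trans (nneseries_lim_ge k.+1 _) => //.
by rewrite big_nat_recr//= leeDr// sume_ge0.
Qed.

Lemma nneseries_cvg0 (v : nat -> R) : (forall i, 0 <= v i)%R ->
  \sum_(0 <= i <oo) (v i)%:E < +oo -> v i @[i --> \oo] --> 0%R.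
Proof.
move=> v0 vy; apply: cvg_series_cvg_0.
have S0 : 0 <= \sum_(0 <= i <oo) (v i)%:E.
  by apply: nneseries_ge0 => i _ _; rewrite lee_fin.
apply: nondecreasing_is_cvgn.
  by apply/nondecreasing_seqP => n; rewrite seriesEnat/= big_nat_recr//= lerDl.
exists (fine (\sum_(0 <= i <oo) (v i)%:E)) => _ [n _ <-].
rewrite seriesEnat/= -lee_fin fineK; last by rewrite ge0_fin_numE.
rewrite -sumEFin; apply: nneseries_lim_ge => i _ _; rewrite lee_fin; exact: v0.
Qed.

Lemma nneseries_measurable d (T : measurableType d) (h : nat -> T -> \bar R) :
  (forall k x, 0 <= h k x) -> (forall k, measurable_fun setT (h k)) ->
  measurable_fun setT (fun x => \sum_(0 <= i <oo) h i x).
Proof.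
move=> h0 mh.
have := @ge0_emeasurable_sum _ _ _ setT h xpredT (fun k x _ _ => h0 k x) (fun k _ => mh k).
by apply: eq_measurable_fun => x _; apply: eq_eseriesl.
Qed.

(** By Tonelli the integral along a path has finite mean. *)
Lemma ae_integral_lty d (T : measurableType d) (P : probability T R)
    (D : set R) (f : R * T -> \bar R) :
  measurable D -> measurable_fun setT f -> (forall z, 0 <= f z) ->
  \int[lebesgue_measure]_(x in D) \int[P]_w f (x, w) < +oo ->
  {ae P, forall w, \int[lebesgue_measure]_(x in D) f (x, w) < +oo}.
Proof.
move=> mD mf f0 fy; set mu := (@lebesgue_measure R).
pose g (z : R * T) := f z * (\1_D z.1)%:E.
have mg : measurable_fun setT g.
  apply: emeasurable_funM => //; apply/measurable_EFinP.
  by apply: measurableT_comp => //; exact: measurable_indic.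
have g0 z : 0 <= g z by rewrite mule_ge0// lee_fin.
have gE w : \int[mu]_(x in D) f (x, w) = \int[mu]_x g (x, w).
  rewrite integral_mkcond; apply: eq_integral => x _.
  by rewrite patchE /g indicE/=; case: ifPn => xD; rewrite ?mule1 ?mule0.
have gPE : \int[mu]_(x in D) \int[P]_w f (x, w) = \int[mu]_x \int[P]_w g (x, w).
  rewrite integral_mkcond; apply: eq_integral => x _.
  rewrite patchE; case: ifPn => xD.
    by apply: eq_integral => w _; rewrite /g indicE xD mule1.
  rewrite -[LHS](@integral0 _ _ _ P setT); apply: eq_integral => w _.
  by rewrite /g indicE (negbTE xD) mule0.
have mG := @measurable_fun_fubini_tonelli_G _ _ _ _ _ mu g mg g0.
have iG : P.-integrable setT (fun w => \int[mu]_x g (x, w)).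
  apply/integrableP; split; first exact: mG.
  apply: le_lt_trans fy; rewrite gPE (@fubini_tonelli _ _ _ _ _ mu P g mg g0) le_eqVlt.
  apply/orP; left.
  apply/eqP; apply: eq_integral => w _; rewrite gee0_abs//; exact: integral_ge0.
have := integrable_ae measurableT iG; apply: filterS => w /(_ Logic.I).
by rewrite gE; rewrite ge0_fin_numE//; exact: integral_ge0.
Qed.

End nonnegative_series.

Section majorants.
Context d (T : measurableType d) (R : realType) (P : probability T R).
Variables (Xs : nat -> {RV P >-> R}) (F : R -> R).
Hypothesis indep : mutually_independent Xs.
Hypothesis cdfE : forall i x, P (Xs i @^-1` `]-oo, x]) = (F x)%:E.
Hypothesis mF : measurable_fun setT F.
Implicit Types (x g r : R) (z : R * T) (n m k i : nat).

Definition hit z i : bool := Xs i z.2 <= z.1.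

Lemma F01 x : 0 <= F x <= 1.
Proof.
apply/andP; split; rewrite -lee_fin -(cdfE 0%N x)//.
by apply: probability_le1; rewrite -[X in measurable X]setTI; exact: measurable_funPT.
Qed.

Lemma onemF_ge0 x : 0 <= 1 - F x.
Proof. by have := F01 x; lra. Qed.

Lemma mFfst : measurable_fun setT (fun z : R * T => F z.1).
Proof. by apply: measurableT_comp mF _. Qed.

Lemma hit_bool_measurable i : measurable_fun setT (fun z => hit z i).
Proof. by apply: measurable_fun_ler => //; apply: measurableT_comp. Qed.

Lemma bool_natr_measurable d' (S : measurableType d') (f : S -> bool) :
  measurable_fun setT f -> measurable_fun setT (fun s => (f s)%:R : R).
Proof.
move=> mf; rewrite (_ : (fun s => _) = fun s => if f s then 1 else 0); last first.
  by apply/funext => s; case: (f s).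
exact: measurable_fun_ifT.
Qed.

Lemma hits_measurable n : measurable_fun setT (fun z => \sum_(i < n) (hit z i)%:R : R).
Proof.
by apply: measurable_sum => i; apply: bool_natr_measurable; exact: hit_bool_measurable.
Qed.

Lemma freq_measurable n : measurable_fun setT (fun z => freq (hit z) n : R).
Proof. by apply: measurable_funM => //; exact: hits_measurable. Qed.

Let A x i := Xs i @^-1` `]-oo, x].

Let mA x i : measurable (A x i).
Proof. by rewrite /A -[X in measurable X]setTI; exact: measurable_funPT. Qed.

Let indepA x (J : {fset nat}) :
  P (\bigcap_(i in [set` J]) A x i) = (\prod_(i <- J) P (A x i))%E.
Proof. by apply: (indep J (A := fun=> `]-oo, x]%classic)) => i; exact: measurable_itv. Qed.

Lemma hitE x w i : (hit (x, w) i)%:R = \1_(A x i) w :> R.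
Proof.
rewrite indicE /hit/=; congr (nat_of_bool _)%:R.
by apply/idP/idP; rewrite inE /A /= in_itv/=.
Qed.

Lemma hitsE x w n : \sum_(i < n) (hit (x, w) i)%:R = \sum_(i < n) \1_(A x i) w :> R.
Proof. by apply: eq_bigr => i _; exact: hitE. Qed.

Lemma measurable_slice (f : R * T -> \bar R) x :
  measurable_fun setT f -> measurable_fun setT (fun w => f (x, w)).
Proof. by move=> mf; apply: measurableT_comp mf _; exact: pair1_measurable. Qed.

Lemma integral_cstP (c : R) : (\int[P]_w c%:E = c%:E)%E.
Proof.
by rewrite integral_cst// -[RHS]mule1; congr (_ * _)%E; exact: probability_setT.
Qed.

(** Majorant of [F_n ^ (- g)] over all [n]: a series over the dyadic times rather than a
    supremum, so that its mean is computed term by term. Since [0 `^ (- g) = 0], the case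
    [F_n = 0] needs no bound. *)
Definition inv_majorant g z : \bar R :=
  ((8 `^ g * F z.1 `^ (- g))%:E + \sum_(0 <= i <oo)
    ((2 `^ g) ^+ i.+1 *
     (\sum_(j < 2 ^ i) (hit z j)%:R < (2 ^ i)%N%:R * F z.1 / 4)%R%:R)%:E)%E.

Let inv_term g i z : R := (2 `^ g) ^+ i.+1 *
     (\sum_(j < 2 ^ i) (hit z j)%:R < (2 ^ i)%N%:R * F z.1 / 4)%R%:R.

Let inv_term_ge0 g i z : 0 <= inv_term g i z.
Proof. by rewrite mulr_ge0// exprn_ge0// powR_ge0. Qed.

Let inv_term_measurable g i : measurable_fun setT (EFin \o inv_term g i).
Proof.
apply/measurable_EFinP; apply: measurable_funM => //; apply: bool_natr_measurable.
apply: measurable_fun_ltr; first exact: hits_measurable.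
by apply: measurable_funM => //; apply: measurable_funM => //; exact: mFfst.
Qed.

Lemma inv_majorant_ge0 g z : (0 <= inv_majorant g z)%E.
Proof.
apply: adde_ge0; first by rewrite lee_fin mulr_ge0 ?powR_ge0.
by apply: nneseries_ge0 => i _ _; rewrite lee_fin; exact: inv_term_ge0.
Qed.

Let F_powR_measurable g : measurable_fun setT (EFin \o (fun z : R * T => 8 `^ g * F z.1 `^ (- g))).
Proof.
apply/measurable_EFinP; apply: measurable_funM => //.
by apply: (measurableT_comp (@measurable_powR R _)); exact: mFfst.
Qed.

Lemma inv_majorant_measurable g : measurable_fun setT (inv_majorant g).
Proof.
apply: emeasurable_funD; first exact: F_powR_measurable.
apply: nneseries_measurable => [k z|k]; last exact: inv_term_measurable.
by rewrite lee_fin; exact: inv_term_ge0.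
Qed.

Lemma inv_majorant_le g z n : 0 < g -> 0 < F z.1 -> (0 < n)%N ->
  ((freq (hit z) n `^ (- g))%:E <= inv_majorant g z)%E.
Proof.
move=> g0 F0 n0; pose i := trunc_log 2 n.
have in2 : (2 ^ i <= n < 2 ^ i.+1)%N by apply: trunc_log_bounds.
apply: le_trans (_ : ((8 `^ g * F z.1 `^ (- g)) + inv_term g i z)%:E <= _)%E.
  by rewrite lee_fin; exact: freq_dyadic_lower.
rewrite EFinD leeD2l//.
apply: (@nneseries_term_le _ (fun i => (inv_term g i z)%:E)) => k.
by rewrite lee_fin; exact: inv_term_ge0.
Qed.

(** Where [F] vanishes, both sides do: the series has only empty events there. Elsewhere
    Chernoff's bound turns it into [dyadic_exp_sum]. *)
Lemma inv_majorant_expectation g : 0 < g -> exists2 C : R, 0 < C &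
  forall x, (\int[P]_w inv_majorant g (x, w) <= (C * F x `^ (- g))%:E)%E.
Proof.
move=> g0; have [K K0 HK] := dyadic_exp_sum g0.
have a0 : 0 < 2 `^ g :> R by exact: powR_gt0.
exists (8 `^ g + 2 `^ g * K) => [|x]; first by rewrite addr_gt0 ?powR_gt0// mulr_gt0.
rewrite /inv_majorant ge0_integralD//=; last 3 first.
- by move=> w _; rewrite lee_fin mulr_ge0 ?powR_ge0.
- by move=> w _; apply: nneseries_ge0 => i _ _; rewrite lee_fin; exact: inv_term_ge0.
- apply: nneseries_measurable => [k w|k].
    by rewrite lee_fin; exact: (inv_term_ge0 g k (x, w)).
  exact: (measurable_slice x (inv_term_measurable g k)).
rewrite integral_cstP [X in (_ <= X%:E)%E]mulrDl EFinD leeD2l//.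
rewrite integral_nneseries//; last first.
  by move=> i; exact: (measurable_slice x (inv_term_measurable g i)).
pose B i := [set w | (\sum_(j < 2 ^ i) \1_(A x j) w < (2 ^ i)%N%:R * F x / 4)%R].
have tE i w : inv_term g i (x, w) = (2 `^ g) ^+ i.+1 * \1_(B i) w.
  by rewrite /inv_term hitsE indicE; congr (_ * (nat_of_bool _)%:R); apply/idP/idP; rewrite inE.
have mB i : measurable (B i).
  apply/(measurable_indicP R).
  have := measurable_slice x (inv_term_measurable g i) => /measurable_EFinP H.
  rewrite (_ : \1_(B i) = fun w => ((2 `^ g) ^+ i.+1)^-1 * inv_term g i (x, w)).
    exact: measurable_funM.
  by apply/funext => w; rewrite tE mulKf// gt_eqF// exprn_gt0.
have E i : (\int[P]_w (inv_term g i (x, w))%:E = ((2 `^ g) ^+ i.+1)%:E * P (B i))%E.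
  under eq_integral do rewrite tE EFinM.
  rewrite ge0_integralZl_EFin ?exprn_ge0 ?(ltW a0)//.
  - by rewrite integral_indic// setIT.
  - by apply/measurable_EFinP; exact: measurable_indic.
under eq_eseriesr do rewrite E.
have /andP[F0 F1] := F01 x.
have [Fx0|Fx0] := eqVneq (F x) 0.
  rewrite eseries0 ?lee_fin ?mulr_ge0 ?powR_ge0 ?(ltW K0)// => i _ _.
  rewrite (_ : B i = set0) ?measure0 ?mule0//.
  apply/seteqP; split => // w; rewrite /B/= Fx0 mulr0 mul0r ltNge.
  by rewrite sumr_ge0.
have Fpos : 0 < F x by rewrite lt_neqAle eq_sym Fx0.
apply: le_trans (lee_nneseries _ _) (nneseries_le_partial (v := fun i =>
    (2 `^ g) ^+ i.+1 * expR (- (2 ^+ i * F x / 4))) _ _).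
- by move=> i _; rewrite mule_ge0// lee_fin exprn_ge0// ltW.
- move=> i _; rewrite EFinM; apply: lee_wpmul2l; first by rewrite lee_fin exprn_ge0// ltW.
  have <- : (2 ^ i)%N%:R = 2 ^+ i :> R by rewrite natrX.
  exact: (@chernoff_lower _ _ _ P (A x) (F x) (mA x) (cdfE^~ x) (indepA x) (2 ^ i)%N).
- by move=> i; rewrite mulr_ge0 ?expR_ge0// exprn_ge0// ltW.
- move=> n; under eq_bigr do rewrite exprS -mulrA.
  by rewrite -mulr_sumr -mulrA ler_wpM2l ?(ltW a0)//; exact: HK.
Qed.

(** Majorant of [(1 - F_n) ^ r] over all [n], for [1 <= r <= 2]. Its mean is of order
    [1 - F] as soon as [1 < r], since the variance at time [m] is at most
    [(1 - F) / m]. *)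
Definition tail_majorant r z : \bar R :=
  ((16 * (1 - F z.1))%:E + \sum_(0 <= i <oo)
    (16 * ((2 ^ i.+1)%N%:R `^ (2 - r) *
      (freq (hit z) (2 ^ i.+1)%N - F z.1) ^+ 2))%:E)%E.

Let dev_measurable n : measurable_fun setT (fun z => (freq (hit z) n - F z.1) ^+ 2).
Proof.
apply: measurable_funX; apply: measurable_funB; first exact: freq_measurable.
exact: mFfst.
Qed.

Lemma dev_expectation x n : (0 < n)%N ->
  (\int[P]_w ((freq (hit (x, w)) n - F x) ^+ 2)%:E = (F x * (1 - F x) / n%:R)%:E)%E.
Proof.
move=> n0.
rewrite -(@variance_mean _ _ _ P (A x) (F x) (mA x) (cdfE^~ x) (indepA x) n n0).
by apply: eq_integral => w _; rewrite /freq hitsE.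
Qed.

Let tail_term r i z : R := 16 * ((2 ^ i.+1)%N%:R `^ (2 - r) *
      (freq (hit z) (2 ^ i.+1)%N - F z.1) ^+ 2).

Let tail_term_ge0 r i z : 0 <= tail_term r i z.
Proof. by rewrite mulr_ge0// mulr_ge0 ?powR_ge0 ?sqr_ge0. Qed.

Let tail_term_measurable r i : measurable_fun setT (EFin \o tail_term r i).
Proof.
by apply/measurable_EFinP; apply: measurable_funM => //; apply: measurable_funM.
Qed.

Let onemF_measurable : measurable_fun setT (EFin \o (fun z : R * T => 16 * (1 - F z.1))).
Proof.
apply/measurable_EFinP; apply: measurable_funM => //; apply: measurable_funB => //.
exact: mFfst.
Qed.

Lemma tail_majorant_ge0 r z : (0 <= tail_majorant r z)%E.
Proof.
apply: adde_ge0; first by rewrite lee_fin mulr_ge0 ?onemF_ge0.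
by apply: nneseries_ge0 => i _ _; rewrite lee_fin; exact: tail_term_ge0.
Qed.

Lemma tail_majorant_measurable r : measurable_fun setT (tail_majorant r).
Proof.
apply: emeasurable_funD; first exact: onemF_measurable.
apply: nneseries_measurable => [k z|k]; last exact: tail_term_measurable.
by rewrite lee_fin; exact: tail_term_ge0.
Qed.

Lemma tail_majorant_le r z n : 1 <= r <= 2 -> (0 < n)%N ->
  (((1 - freq (hit z) n) `^ r)%:E <= tail_majorant r z)%E.
Proof.
move=> r12 n0; pose i := trunc_log 2 n.
have in2 : (2 ^ i <= n < 2 ^ i.+1)%N by apply: trunc_log_bounds.
apply: le_trans (_ : ((16 * (1 - F z.1)) + tail_term r i z)%:E <= _)%E.
  by rewrite lee_fin; apply: freq_dyadic_upper => //; exact: F01.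
rewrite EFinD leeD2l//.
apply: (@nneseries_term_le _ (fun i => (tail_term r i z)%:E)) => k.
by rewrite lee_fin; exact: tail_term_ge0.
Qed.

Lemma tail_majorant_expectation r : 1 < r -> exists2 C : R, 0 < C &
  forall x, (\int[P]_w tail_majorant r (x, w) <= (C * (1 - F x))%:E)%E.
Proof.
move=> r1; pose q : R := 2 `^ (1 - r).
have q0 : 0 < q by exact: powR_gt0.
have q1 : q < 1.
  by rewrite /q /powR pnatr_eq0/= -[ltRHS]expR0 ltr_expR nmulr_rlt0 ?ln_gt0 ?ltr1n// subr_lt0.
have q1' : 0 < 1 - q by lra.
exists (16 + 16 * (1 - q)^-1) => [|x]; first by rewrite addr_gt0// mulr_gt0// invr_gt0.
rewrite /tail_majorant ge0_integralD//=; last 3 first.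
- by move=> w _; rewrite lee_fin mulr_ge0 ?onemF_ge0.
- by move=> w _; apply: nneseries_ge0 => i _ _; rewrite lee_fin; exact: tail_term_ge0.
- apply: nneseries_measurable => [k w|k].
    by rewrite lee_fin; exact: (tail_term_ge0 r k (x, w)).
  exact: (measurable_slice x (tail_term_measurable r k)).
rewrite integral_cstP [X in (_ <= X%:E)%E]mulrDl EFinD leeD2l//.
rewrite integral_nneseries//; last 2 first.
- by move=> i; exact: (measurable_slice x (tail_term_measurable r i)).
- by move=> i w _; rewrite lee_fin; exact: (tail_term_ge0 r i (x, w)).
have /andP[F0 F1] := F01 x.
have E i : (\int[P]_w (tail_term r i (x, w))%:E =
    (16 * ((2 ^ i.+1)%N%:R `^ (2 - r) * (F x * (1 - F x) / (2 ^ i.+1)%N%:R)))%:E)%E.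
  rewrite mulrA EFinM -dev_expectation ?expn_gt0// -ge0_integralZl_EFin//.
  - by apply: eq_integral => w _; rewrite /tail_term mulrA EFinM.
  - by move=> w _; rewrite lee_fin sqr_ge0.
  - apply/measurable_EFinP.
    have := measurable_slice x (_ : measurable_fun setT
      (EFin \o (fun z => (freq (hit z) (2 ^ i.+1) - F z.1) ^+ 2))).
    move=> /(_ _)/measurable_EFinP; apply.
    by apply/measurable_EFinP; exact: dev_measurable.
under eq_eseriesr do rewrite E.
apply: nneseries_le_partial => [i|n].
  by rewrite !mulr_ge0 ?powR_ge0 ?invr_ge0 ?onemF_ge0.
have term i : 16 * ((2 ^ i.+1)%N%:R `^ (2 - r) * (F x * (1 - F x) / (2 ^ i.+1)%N%:R))
    <= 16 * (1 - F x) * q ^+ i.+1.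
  have M0 : 0 < (2 ^ i.+1)%N%:R :> R by rewrite ltr0n expn_gt0.
  have -> : q ^+ i.+1 = (2 ^ i.+1)%N%:R `^ (1 - r).
    rewrite natrX -[2 ^+ i.+1]powR_mulrn// -powRrM mulrC powRrM.
    by rewrite powR_mulrn ?powR_ge0.
  have -> : (2 ^ i.+1)%N%:R `^ (2 - r) = (2 ^ i.+1)%N%:R `^ (1 - r) * (2 ^ i.+1)%N%:R :> R.
    rewrite -[X in _ * X]powRr1 ?(ltW M0)// -powRD; last by rewrite (gt_eqF M0) implybT.
    by congr (_ `^ _); lra.
  have p0 := powR_ge0 (2 ^ i.+1)%N%:R (1 - r).
  move: ((2 ^ i.+1)%N%:R : R) M0 p0 => M M0 p0.
  rewrite (_ : M `^ (1 - r) * M * _ = F x * ((1 - F x) * M `^ (1 - r))); last first.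
    by field; rewrite gt_eqF.
  rewrite -mulrA ler_wpM2l// ler_piMl// mulr_ge0// onemF_ge0//.
apply: le_trans (ler_sum _ (fun (i : 'I_n) _ => term i)) _.
rewrite -mulr_sumr mulrAC ler_wpM2r ?onemF_ge0 ?mulr_ge0// ler_wpM2l//.
have : forall k, \sum_(i < k) q ^+ i.+1 <= (1 - q)^-1 * (1 - q ^+ k).
  elim=> [|k IH]; first by rewrite big_ord0 subrr mulr0.
  rewrite big_ord_recr/=; apply: le_trans (lerD IH (lexx _)) _.
  rewrite -(ler_pM2l q1') mulrDr !mulrA mulfV ?gt_eqF// !mul1r exprS.
  have Q0 := exprn_ge0 k (ltW q0); rewrite -subr_ge0.
  rewrite (_ : _ - _ = q ^+ k * (1 - q) ^+ 2); first by rewrite mulr_ge0 ?sqr_ge0.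
  by ring.
move=> /(_ n) H; apply: le_trans H _; rewrite ler_piMr ?invr_ge0 ?(ltW q1')//.
by rewrite gerBl exprn_ge0// ltW.
Qed.

(** Finiteness of this sum forces the law of large numbers at [z.1]. *)
Definition dev_majorant z : \bar R :=
  (\sum_(0 <= k <oo) ((freq (hit z) (k.+1 ^ 2)%N - F z.1) ^+ 2)%:E)%E.

Lemma dev_majorant_ge0 z : (0 <= dev_majorant z)%E.
Proof. by apply: nneseries_ge0 => i _ _; rewrite lee_fin sqr_ge0. Qed.

Lemma dev_majorant_measurable : measurable_fun setT dev_majorant.
Proof.
apply: nneseries_measurable => [k z|k]; first by rewrite lee_fin sqr_ge0.
by apply/measurable_EFinP; exact: dev_measurable.
Qed.

Lemma dev_majorant_cvg z : (dev_majorant z < +oo)%E ->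
  freq (hit z) n @[n --> \oo] --> F z.1.
Proof.
move=> /nneseries_cvg0 H; apply: freq_cvg_squares.
have /H{}H : forall i, 0 <= (freq (hit z) (i.+1 ^ 2)%N - F z.1) ^+ 2.
  by move=> i; rewrite sqr_ge0.
apply/cvgrPdist_le => /= e e0.
have e2 : 0 < e ^+ 2 by rewrite exprn_gt0.
move/cvgrPdist_le : H => /(_ _ e2); apply: filterS => k.
rewrite sub0r normrN normrX distrC => H.
by rewrite -(ler_pXn2r (ltn0Sn 1))// nnegrE// ltW.
Qed.

Lemma dev_majorant_expectation x :
  (\int[P]_w dev_majorant (x, w) <= (2 * (1 - F x))%:E)%E.
Proof.
have /andP[F0 F1] := F01 x.
have mdev k : measurable_fun setT (EFin \o (fun z => (freq (hit z) k - F z.1) ^+ 2)).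
  by apply/measurable_EFinP; exact: dev_measurable.
rewrite /dev_majorant integral_nneseries//; last 2 first.
- by move=> k; exact: (measurable_slice x (mdev _)).
- by move=> k w _; rewrite lee_fin sqr_ge0.
under eq_eseriesr do rewrite dev_expectation ?expn_gt0//.
apply: nneseries_le_partial => [i|n].
  by rewrite !mulr_ge0 ?invr_ge0 ?onemF_ge0.
have sq : forall k, \sum_(i < k) ((i.+1 ^ 2)%N%:R : R)^-1 <= 2 - 2 / k.+1%:R.
  elim=> [|k IH]; first by rewrite big_ord0 divr1 subrr.
  rewrite big_ord_recr/=; apply: le_trans (lerD IH (lexx _)) _.
  have k1 : 1 <= k.+1%:R :> R by rewrite ler1n.
  rewrite natrX -[k.+2%:R]natr1; move: (k.+1%:R : R) k1 => y y1.
  rewrite -subr_ge0 (_ : _ - _ = (y - 1) / (y ^+ 2 * (y + 1))).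
    by rewrite divr_ge0 ?mulr_ge0 ?sqr_ge0//; lra.
  by field; rewrite !gt_eqF//; lra.
apply: le_trans (_ : \sum_(i < n) (1 - F x) * ((i.+1 ^ 2)%N%:R : R)^-1 <= _).
  apply: ler_sum => i _; rewrite ler_wpM2r ?invr_ge0// ler_piMl// onemF_ge0//.
rewrite -mulr_sumr mulrC ler_wpM2r ?onemF_ge0//; apply: le_trans (sq n) _.
by rewrite gerBl divr_ge0.
Qed.

(** Infinite as soon as some observation falls where [F] vanishes. There the kernel must be
    evaluated at [0] exactly, since it may be unbounded near [0]. *)
Definition null_majorant z : \bar R :=
  (\sum_(0 <= i <oo) (if (F z.1 == 0%R) && hit z i then +oo else 0))%E.

Lemma null_majorant_ge0 z : (0 <= null_majorant z)%E.
Proof. by apply: nneseries_ge0 => i _ _; case: ifP. Qed.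

Let null_term_measurable i :
  measurable_fun setT (fun z => if (F z.1 == 0%R) && hit z i then +oo else 0 : \bar R)%E.
Proof.
apply: measurable_fun_ifT => //; apply: measurable_and; last exact: hit_bool_measurable.
by apply: measurable_fun_eqr => //; exact: mFfst.
Qed.

Lemma null_majorant_measurable : measurable_fun setT null_majorant.
Proof.
apply: nneseries_measurable => [k z|k]; first by case: ifP.
exact: null_term_measurable.
Qed.

Lemma null_majorant_freq z n : (null_majorant z < +oo)%E -> F z.1 = 0 ->
  freq (hit z) n = 0 :> R.
Proof.
move=> H F0; rewrite /freq big1 ?mul0r// => i _.
case: (boolP (hit z i)) => // hi; exfalso.
suff : (+oo <= null_majorant z)%E by rewrite leNgt H.
pose v k : \bar R := (if (F z.1 == 0%R) && hit z k then +oo else 0)%E.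
have v0 k : (0 <= v k)%E by rewrite /v; case: ifP.
by apply: le_trans (nneseries_term_le i v0); rewrite /v F0 eqxx hi.
Qed.

Lemma null_majorant_expectation x : (\int[P]_w null_majorant (x, w) = 0)%E.
Proof.
rewrite /null_majorant integral_nneseries//; last 2 first.
- by move=> k; exact: (measurable_slice x (null_term_measurable k)).
- by move=> k w _; case: ifP.
apply: eseries0 => i _ _; have [F0|F0] := eqVneq (F x) 0; last first.
  by rewrite -[RHS](@integral0 _ _ _ P setT); apply: eq_integral => w _.
transitivity (\int[P]_w (+oo * (\1_(A x i) w)%:E))%E.
  by apply: eq_integral => w _; rewrite -hitE/=; case: hit; rewrite ?mule1 ?mule0.
rewrite ge0_integralZl//; last by apply/measurable_EFinP; exact: measurable_indic.
rewrite integral_indic// setIT; transitivity (+oo * P (A x i))%E; first by [].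
by rewrite cdfE F0 mule0.
Qed.

End majorants.

(** * Passage to the limit under the integral *)

Section ae_limits.
Context d (T : measurableType d) (R : realType) (mu : {measure set T -> \bar R}).
Local Open Scope ereal_scope.
Implicit Types (D : set T) (f : T -> \bar R).

Lemma ge0_integrable D f : measurable D -> measurable_fun D f ->
  (forall x, D x -> 0 <= f x) -> \int[mu]_(x in D) f x < +oo -> mu.-integrable D f.
Proof.
move=> mD mf f0 fy; apply/integrableP; split => //.
rewrite (_ : \int[mu]_(x in D) `|f x| = \int[mu]_(x in D) f x)//.
by apply: eq_integral => x; rewrite inE => Dx; rewrite gee0_abs// f0.
Qed.

Lemma ge0_ae_lty D f : measurable D -> measurable_fun D f ->
  (forall x, D x -> 0 <= f x) -> \int[mu]_(x in D) f x < +oo ->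
  {ae mu, forall x, D x -> f x < +oo}.
Proof.
move=> mD mf f0 fy; have := integrable_ae mD (ge0_integrable mD mf f0 fy).
by apply: filterS => x H Dx; rewrite -ge0_fin_numE ?f0//; exact: H.
Qed.

(** Fatou's lemma for an infinite limit integral. *)
Lemma ae_cvg_integral_pinfty D (f_ : nat -> T -> \bar R) f : measurable D ->
  (forall n, measurable_fun D (f_ n)) -> measurable_fun D f ->
  (forall n x, D x -> 0 <= f_ n x) -> (forall x, D x -> 0 <= f x) ->
  {ae mu, forall x, D x -> f_ n x @[n --> \oo] --> f x} ->
  \int[mu]_(x in D) f x = +oo ->
  \int[mu]_(x in D) f_ n x @[n --> \oo] --> \int[mu]_(x in D) f x.
Proof.
move=> mD mf_ mf f_0 f0 f_f fy; rewrite fy.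
pose u n := \int[mu]_(x in D) f_ n x.
have Fa : +oo <= limn_einf u.
  rewrite -fy; apply: le_trans (fatou mu mD mf_ f_0).
  apply: ae_ge0_le_integral => //.
  - move=> x Dx; rewrite limn_einf_lim; apply: lime_ge; first exact: is_cvg_einfs.
    by apply: nearW => n; apply: le_ereal_inf_tmp => _ [m _ <-]; exact: f_0.
  - rewrite /limn_einf; apply: measurableT_comp => //.
    by apply: measurable_fun_limn_esup => n; apply: measurableT_comp.
  - apply: filterS f_f => x H Dx; have {}H := H Dx.
    by rewrite is_cvg_limn_einfE ?(cvg_lim _ H)//; apply/cvg_ex; exists (f x).
have {Fa}Ey : limn_einf u = +oo by apply/eqP; rewrite -leye_eq.
have cE : einfs u n @[n --> \oo] --> +oo.
  by rewrite -Ey limn_einf_lim; exact: is_cvg_einfs.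
apply/cvgeyPge => A; move/cvgeyPge : cE => /(_ A); apply: filterS => n An.
by apply: le_trans An _; apply: ereal_inf_lbound; exists n => /=.
Qed.

End ae_limits.

(** * Convergence along a sample path *)

Section path.
Context d (T : measurableType d) (R : realType) (P : probability T R).
Variables (Xs : nat -> {RV P >-> R}) (F : R -> R).
Hypothesis mF : measurable_fun setT F.
Hypothesis cdfE : forall i x, P (Xs i @^-1` `]-oo, x]) = (F x)%:E.
Variables (alpha : R).
Hypothesis alpha01 : 0 < alpha < 1.
Local Notation mu := (@lebesgue_measure R).
Local Notation H := (efcpe_kernel alpha).
Local Notation D := (`[0%R, +oo[%classic : set R).
Implicit Types (x : R) (w : T) (n : nat).

Let F01 x : 0 <= F x <= 1 := F01 cdfE x.

Local Notation Fn w n x := (freq (hit Xs (x, w)) n : R).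
Local Notation g := (alpha^-1 - 1).
Local Notation r := (Num.min alpha^-1 2).

Lemma empirical_cdf_freq w n x : (0 < n)%N ->
  empirical_cdf (mkseq (fun i => Xs i w) n) x = Fn w n x.
Proof.
move=> n0; rewrite empirical_cdfE size_mkseq// /freq; congr (_ / _).
rewrite /mkseq count_map -sum1_count big_mkcond/= natr_sum.
rewrite (_ : iota 0 n = index_iota 0 n); last by rewrite /index_iota subn0.
rewrite big_mkord.
by apply: eq_bigr => i _; rewrite /hit/=; case: ifP.
Qed.

Lemma efcpe_freq w n : (0 < n)%N ->
  efcpe alpha (empirical_cdf (mkseq (fun i => Xs i w) n)) =
  (\int[mu]_(x in D) (H (Fn w n x))%:E)%E.
Proof.
move=> n0; apply: eq_integral => x _.
by rewrite empirical_cdf_freq// efcpe_integrandE//; exact: freq01.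
Qed.

Lemma efcpe_cdf : efcpe alpha F = (\int[mu]_(x in D) (H (F x))%:E)%E.
Proof. by apply: eq_integral => x _; rewrite efcpe_integrandE//; exact: F01. Qed.

Lemma freq_slice_measurable w n : measurable_fun setT (fun x => Fn w n x).
Proof.
apply: (measurableT_comp (freq_measurable Xs n) (pair2_measurable w)).
Qed.

Lemma kernel_measurable (D' : set R) (G : R -> R) : measurable_fun setT G ->
  measurable_fun D' (fun x => (H (G x))%:E).
Proof.
move=> mG; apply/measurable_EFinP; apply: measurable_funTS.
exact: (measurableT_comp (efcpe_kernel_measurable alpha01) mG).
Qed.

Lemma freq_nondecreasing w n x y : x <= y -> Fn w n x <= Fn w n y.
Proof.
move=> xy; rewrite /freq ler_wpM2r ?invr_ge0//; apply: ler_sum => i _.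
rewrite ler_nat /hit/=; case: (leP (Xs i w) x) => // h.
by rewrite (le_trans h xy).
Qed.

Lemma powR_min_exponent (y : R) : 0 <= y <= 1 -> y `^ alpha^-1 <= y `^ r.
Proof.
move=> /andP[y0 y1]; case/andP: alpha01 => a0 a1.
have i0 : 0 < alpha^-1 by rewrite invr_gt0.
have r0 : 0 < r by rewrite lt_min i0/=.
move: y0; rewrite le_eqVlt => /predU1P[<-|y0]; first by rewrite !powR0 ?gt_eqF.
by apply: ger_powR; rewrite ?y0 ?y1// ge_min lexx.
Qed.

(** The kernel controls [F ^ (- g)], up to an additive constant coming from the
    region where [F] is not small. *)
Lemma powR_le_kernel : exists2 K, 0 < K & forall u, 0 <= u <= 1 ->
  u `^ (- g) <= K * H u + 2 `^ g.
Proof.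
case/andP: (alpha01) => a0 a1; have [c c0 Hc] := efcpe_kernel_lower alpha01.
have g0 : 0 < g by rewrite subr_gt0 invf_gt1.
have h0 : 0 < 2^-1 `^ alpha^-1 :> R by apply: powR_gt0; rewrite invr_gt0.
exists (c * 2^-1 `^ alpha^-1)^-1 => [|u /andP[u0 u1]]; first by rewrite invr_gt0 mulr_gt0.
have Hu0 : 0 <= (c * 2^-1 `^ alpha^-1)^-1 * H u.
  by apply: mulr_ge0; [rewrite invr_ge0 ltW// mulr_gt0|exact: efcpe_kernel_ge0].
have [->|un0] := eqVneq u 0.
  rewrite powR0; last by rewrite oppr_eq0 gt_eqF.
  by rewrite efcpe_kernel0 mulr0 add0r powR_ge0.
have up : 0 < u by rewrite lt_neqAle eq_sym un0.
have [u2|u2] := leP u 2^-1; last first.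
  apply: le_trans (_ : 2 `^ g <= _); last by rewrite lerDr.
  rewrite powRN -(invrK (2 `^ g)) lef_pV2 ?posrE ?invr_gt0 ?powR_gt0//.
  rewrite -powRN -[- g]mulN1r powRrM powR_inv1//.
  by apply: ge0_ler_powR; rewrite ?nnegrE ?(ltW g0) ?(ltW up) ?(ltW u2)// invr_ge0.
apply: le_trans (_ : (c * 2^-1 `^ alpha^-1)^-1 * H u <= _); last by rewrite lerDl powR_ge0.
rewrite ler_pdivlMl ?mulr_gt0//.
have u01 : 0 < u <= 1 by rewrite up.
apply: le_trans (Hc u u01); rewrite -mulrA ler_wpM2l ?(ltW c0)// mulrC.
rewrite -[1 - alpha^-1]opprB ler_wpM2l ?powR_ge0//.
apply: ge0_ler_powR; rewrite ?nnegrE ?invr_ge0 ?(ltW a0)//; lra.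
Qed.

Variables (x0 : R) (x0_ge0 : 0 <= x0) (Fx0 : 2^-1 <= F x0).

Lemma inv_power_integral_lty : (\int[mu]_(x in D) (H (F x))%:E < +oo)%E ->
  (\int[mu]_(x in `[0%R, x0]) (F x `^ (- g))%:E < +oo)%E.
Proof.
have [K K0 HK] := powR_le_kernel => Hy.
have D0D : `[0%R, x0] `<=` D.
  by move=> x /=; rewrite !in_itv/= => /andP[->].
apply: le_lt_trans (_ : \int[mu]_(x in `[0%R, x0])
   (K%:E * (H (F x))%:E + (2 `^ g)%:E) < +oo)%E.
  apply: ge0_le_integral => //.
  - by move=> x _; rewrite lee_fin powR_ge0.
  - apply/measurable_EFinP; apply: measurable_funTS.
    exact: (measurableT_comp (@measurable_powR R _) mF).
  - apply: emeasurable_funD => //; apply: emeasurable_funM => //.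
    exact: kernel_measurable.
  - by move=> x _; rewrite -EFinM -EFinD lee_fin; apply: HK; exact: F01.
have Hge0 x : (0 <= (H (F x))%:E)%E.
  by rewrite lee_fin efcpe_kernel_ge0//; have /andP[] := F01 x.
rewrite ge0_integralD//; last 2 first.
- by move=> x _; rewrite mule_ge0// lee_fin ltW.
- apply: emeasurable_funM => //; exact: kernel_measurable.
rewrite lte_add_pinfty//.
  rewrite ge0_integralZl_EFin ?(ltW K0)//; last exact: kernel_measurable.
  rewrite lte_mul_pinfty ?lee_fin ?(ltW K0)//.
  apply: le_lt_trans Hy; apply: ge0_subset_integral => //; exact: kernel_measurable.
rewrite integral_cst//= lebesgue_measure_itv/=.
by case: ifPn => _; rewrite -?EFinB -?EFinM ?mule0 ?ltry.
Qed.

Variable (w : T).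
Hypothesis dev_lty : (\int[mu]_(x in D) dev_majorant Xs F (x, w) < +oo)%E.
Hypothesis null_lty : (\int[mu]_(x in D) null_majorant Xs F (x, w) < +oo)%E.
Hypothesis tail_lty : (\int[mu]_(x in D) tail_majorant Xs F r (x, w) < +oo)%E.
Hypothesis dev_x0 : (dev_majorant Xs F (x0, w) < +oo)%E.
Hypothesis inv_lty : (\int[mu]_(x in `[0%R, x0]) (F x `^ (- g))%:E < +oo)%E ->
  (\int[mu]_(x in `[0%R, x0]) inv_majorant Xs F g (x, w) < +oo)%E.

Let slice_measurable (f : R * T -> \bar R) (D' : set R) : measurable_fun setT f ->
  measurable_fun D' (fun x => f (x, w)).
Proof.
by move=> mf; apply: measurable_funTS; apply: (measurableT_comp mf (pair2_measurable w)).
Qed.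

Let ae_filter : Filter (nbhs (almost_everywhere mu)).
Proof. exact: (@ae_filter_ringOfSetsType _ _ _ mu). Qed.

Lemma ae_freq_cvg : {ae mu, forall x, D x -> Fn w n x @[n --> \oo] --> F x /\
  (F x = 0 -> forall n, Fn w n x = 0)}.
Proof.
have mD : measurable D by exact: measurable_itv.
have A1 := @ge0_ae_lty _ _ _ mu D _ mD (slice_measurable (D' := D)
  (dev_majorant_measurable Xs mF)) (fun x _ => dev_majorant_ge0 Xs F (x, w)) dev_lty.
have A2 := @ge0_ae_lty _ _ _ mu D _ mD (slice_measurable (D' := D)
  (null_majorant_measurable Xs mF)) (fun x _ => null_majorant_ge0 Xs F (x, w)) null_lty.
apply: (@filterS2 _ _ ae_filter _ _ _ _ A1 A2) => x h1 h2 Dx.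
split; first exact: dev_majorant_cvg (h1 Dx).
by move=> F0 n; exact: null_majorant_freq (h2 Dx) F0.
Qed.

Lemma ae_kernel_cvg : {ae mu, forall x, D x ->
  (H (Fn w n x))%:E @[n --> \oo] --> (H (F x))%:E}.
Proof.
apply: (@filterS _ _ ae_filter _ _ _ ae_freq_cvg) => x h Dx; have [hc h0] := h Dx.
apply: cvg_EFin; first exact: nearW.
have [Fx|Fx] := eqVneq (F x) 0.
  rewrite Fx; apply: cvg_near_cst; by apply: nearW => n /=; rewrite h0.
apply: efcpe_kernel_cvg => //.
by rewrite lt_neqAle eq_sym Fx/=; have /andP[] := F01 x.
Qed.

Lemma kernel_freq_ge0 n x : (0 <= (H (Fn w n x))%:E)%E.
Proof.
by rewrite lee_fin efcpe_kernel_ge0//; have /andP[] := freq01 (R := R) (hit Xs (x, w)) n.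
Qed.

Lemma kernel_F_ge0 x : (0 <= (H (F x))%:E)%E.
Proof. by rewrite lee_fin efcpe_kernel_ge0//; have /andP[] := F01 x. Qed.

(** For [0 <= x <= x0] the kernel is dominated through [F_n ^ (- g)]; beyond [x0], where
    eventually [F_n >= 1/4] by monotonicity, through [(1 - F_n) ^ r]. *)
Lemma efcpe_path_cvg :
  efcpe alpha (empirical_cdf (mkseq (fun i => Xs i w) n)) @[n --> \oo]
    --> efcpe alpha F.
Proof.
case/andP: (alpha01) => a0 a1.
have g0 : 0 < g by rewrite subr_gt0 invf_gt1.
have r1 : 1 < r by rewrite lt_min invf_gt1// a1 ltr1n.
have r12 : 1 <= r <= 2 by rewrite (ltW r1) ge_min lexx orbT.
have mD : measurable D by exact: measurable_itv.
rewrite efcpe_cdf.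
suff : (\int[mu]_(x in D) (H (Fn w n x))%:E)%E @[n --> \oo]
    --> (\int[mu]_(x in D) (H (F x))%:E)%E.
  apply: cvg_trans; apply: near_eq_cvg; near=> n; apply/esym/efcpe_freq.
  by near: n; exact: nbhs_infty_gt.
have [Hy|Hy] := eqVneq (\int[mu]_(x in D) (H (F x))%:E)%E +oo%E.
  have K := (@ae_cvg_integral_pinfty _ _ _ mu D
    (fun n x => (H (Fn w n x))%:E) (fun x => (H (F x))%:E) mD
    (fun n => @kernel_measurable D _ (@freq_slice_measurable w n))
    (@kernel_measurable D _ mF) (fun n x _ => kernel_freq_ge0 n x)
    (fun x _ => kernel_F_ge0 x) ae_kernel_cvg Hy).
  exact: K.
have Hlty : (\int[mu]_(x in D) (H (F x))%:E < +oo)%E by rewrite ltey.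
have inv_y := inv_lty (inv_power_integral_lty Hlty).
have [C C0 HC] := efcpe_kernel_upper alpha01.
have [N HN] : exists N, forall n, (N <= n)%N -> (0 < n)%N /\ 4^-1 <= Fn w n x0.
  have := dev_majorant_cvg dev_x0 => /cvgrPdist_le/= /(_ 4^-1).
  rewrite invr_gt0 ltr0n => /(_ isT) [N _ HN]; exists N.+1 => n Nn.
  split; first exact: leq_trans Nn.
  have := HN n (ltnW Nn); rewrite /= ler_norml => /andP[_].
  by move: Fx0; lra.
pose G (x : R) : \bar R := (C%:E * (inv_majorant Xs F g (x, w) * (\1_(`[0%R, x0]) x)%:E) +
  (C * 4 `^ g)%:E * tail_majorant Xs F r (x, w))%E.
have inv0 x := inv_majorant_ge0 Xs F g (x, w).
have tail0 x := tail_majorant_ge0 cdfE r (x, w).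
have ind0 x : (0 <= (\1_(`[0%R, x0]) x)%:E :> \bar R)%E by rewrite lee_fin.
have m1 : measurable_fun D
    (fun x => inv_majorant Xs F g (x, w) * (\1_(`[0%R, x0]) x)%:E)%E.
  apply: emeasurable_funM; first exact: slice_measurable (inv_majorant_measurable Xs mF g).
  by apply/measurable_EFinP; exact: measurable_indic.
have m2 : measurable_fun D (fun x => tail_majorant Xs F r (x, w)).
  exact: slice_measurable (tail_majorant_measurable Xs mF r).
have iG : mu.-integrable D G.
  apply: ge0_integrable => //.
  - by apply: emeasurable_funD; exact: emeasurable_funM.
  - by move=> x _; rewrite adde_ge0// mule_ge0// ?mule_ge0// lee_fin ?mulr_ge0 ?powR_ge0// ltW.
  rewrite ge0_integralD//; last 4 first.
  - by move=> x _; rewrite mule_ge0// ?mule_ge0// lee_fin ltW.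
  - exact: emeasurable_funM.
  - by move=> x _; rewrite mule_ge0// lee_fin mulr_ge0 ?powR_ge0// ltW.
  - exact: emeasurable_funM.
  rewrite lte_add_pinfty//.
    rewrite ge0_integralZl_EFin ?(ltW C0)//; last by move=> x _; rewrite mule_ge0.
    rewrite lte_mul_pinfty ?lee_fin ?(ltW C0)//.
    apply: le_lt_trans inv_y; rewrite [leRHS]integral_mkcond [leLHS]integral_mkcond.
    apply: ge0_le_integral => //.
    - by move=> x _; rewrite patchE; case: ifP => // _; rewrite mule_ge0.
    - by apply/(measurable_restrictT _ mD).
    - apply/(measurable_restrictT _ (measurable_itv _)).
      exact: slice_measurable (inv_majorant_measurable Xs mF g).
    - move=> x _; rewrite !patchE indicE; case: ifP => _; last by case: ifP.
      by case: ifP => _; rewrite ?mule1 ?mule0.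
  rewrite ge0_integralZl_EFin ?mulr_ge0 ?powR_ge0 ?(ltW C0)//.
  by rewrite lte_mul_pinfty ?lee_fin ?mulr_ge0 ?powR_ge0 ?(ltW C0).
rewrite -(cvg_shiftn N).
have cv : {ae mu, forall x, D x ->
    (H (Fn w (n + N) x))%:E @[n --> \oo] --> (H (F x))%:E}.
  apply: (@filterS _ _ ae_filter _ _ _ ae_kernel_cvg) => x h Dx.
  move=> U /(h Dx) [M _ HM]; exists M => [//|n Mn].
  exact: HM _ (leq_trans Mn (leq_addr N n)).
suff dom : {ae mu, forall x n, D x -> (`|(H (Fn w (n + N) x))%:E| <= G x)%E}.
  have [_ _ K] := @dominated_convergence _ _ _ mu D mD
    (fun n x => (H (Fn w (n + N) x))%:E) (fun x => (H (F x))%:E) G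
    (fun n => @kernel_measurable D _ (@freq_slice_measurable w (n + N)))
    (@kernel_measurable D _ mF) cv iG dom.
  exact: K.
apply: (@filterS _ _ ae_filter _ _ _ ae_freq_cvg) => x h n Dx; have [_ h0] := h Dx.
have [npos Fnx0] := HN (n + N)%N (leq_addl _ _).
rewrite gee0_abs; last exact: kernel_freq_ge0.
have /andP[f0 f1] := freq01 (R := R) (hit Xs (x, w)) (n + N).
have [Fn0|Fnn0] := eqVneq (Fn w (n + N) x) 0.
  rewrite Fn0 efcpe_kernel0 /G.
  by rewrite adde_ge0// mule_ge0// ?mule_ge0// lee_fin ?mulr_ge0 ?powR_ge0// ltW.
have fpos : 0 < Fn w (n + N) x by rewrite lt_neqAle eq_sym Fnn0.
have Fpos : 0 < F x.
  rewrite lt_neqAle; have /andP[-> _] := F01 x; rewrite andbT eq_sym.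
  by apply/eqP => /h0 /(_ (n + N)%N) K; rewrite K eqxx in Fnn0.
have HH : H (Fn w (n + N) x) <= C * (Fn w (n + N) x `^ (- g) *
    (1 - Fn w (n + N) x) `^ alpha^-1).
  by rewrite opprB; apply: HC; rewrite fpos.
have om : 0 <= 1 - Fn w (n + N) x <= 1 by lra.
have pr := powR_min_exponent om.
case/andP: om => om0 om1.
rewrite /G indicE; case: (boolP (x \in _)) => [_|].
  rewrite mule1; apply: le_trans (leeDl _ _); last first.
    by rewrite mule_ge0// lee_fin mulr_ge0 ?powR_ge0// ltW.
  apply: le_trans (lee_wpmul2l _ (inv_majorant_le Xs (z := (x, w)) g0 Fpos npos));
    last by rewrite lee_fin ltW.
  rewrite -EFinM lee_fin; apply: le_trans HH _; rewrite ler_wpM2l ?(ltW C0)//.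
  rewrite ler_piMr ?powR_ge0//; apply: le_trans (_ : 1 `^ alpha^-1 <= _).
    by apply: ge0_ler_powR; rewrite ?nnegrE ?invr_ge0 ?(ltW a0).
  by rewrite powR1.
rewrite notin_setE /= in_itv/= => /negP; rewrite negb_and.
have x0' : 0 <= x by move: Dx; rewrite /= in_itv/= andbT.
rewrite x0'/= -ltNge => x0x; rewrite mule0 mule0 add0e.
apply: le_trans (lee_wpmul2l _ (tail_majorant_le cdfE (x, w) r12 npos)); last first.
  by rewrite lee_fin mulr_ge0 ?powR_ge0// ltW.
rewrite -EFinM lee_fin; apply: le_trans HH _; rewrite -mulrA ler_wpM2l ?(ltW C0)//.
apply: ler_pM; rewrite ?powR_ge0//.
have f4 : 4^-1 <= Fn w (n + N) x.
  by apply: le_trans Fnx0 (freq_nondecreasing w _ (ltW x0x)).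
rewrite powRN -(invrK (4 `^ g)) lef_pV2 ?posrE ?invr_gt0 ?powR_gt0//.
rewrite -powRN -[- g]mulN1r powRrM powR_inv1//.
by apply: ge0_ler_powR; rewrite ?nnegrE ?(ltW g0) ?invr_ge0.
Unshelve. all: by end_near.
Qed.

End path.

(** * Almost sure convergence *)

Section almost_sure.
Context d (T : measurableType d) (R : realType) (P : probability T R).
Local Notation mu := (@lebesgue_measure R).
Local Notation D := (`[0%R, +oo[%classic : set R).

Lemma ae_path_integral_lty (D' : set R) (f : R * T -> \bar R) (C : R) (h : R -> R) :
  measurable D' -> measurable_fun setT f -> (forall z, 0 <= f z)%E ->
  measurable_fun setT h -> (forall x, 0 <= h x) -> 0 < C ->
  (forall x, \int[P]_w f (x, w) <= (C * h x)%:E)%E ->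
  (\int[mu]_(x in D') (h x)%:E < +oo)%E ->
  {ae P, forall w, (\int[mu]_(x in D') f (x, w) < +oo)%E}.
Proof.
move=> mD mf f0 mh h0 C0 fh hy; apply: ae_integral_lty => //.
have mhE : measurable_fun D' (fun x => (h x)%:E).
  by apply/measurable_EFinP; exact: measurable_funTS.
apply: le_lt_trans (_ : \int[mu]_(x in D') (C%:E * (h x)%:E) < +oo)%E.
  apply: ge0_le_integral => //.
  - by move=> x _; exact: integral_ge0.
  - by apply: measurable_funTS; exact: (measurable_fun_fubini_tonelli_F (m2 := P) f mf f0).
  - exact: emeasurable_funM.
rewrite ge0_integralZl_EFin ?(ltW C0)//; last by move=> x _; rewrite lee_fin.
by rewrite lte_mul_pinfty// lee_fin ltW.
Qed.

(** The tail integral of a nonnegative variable is its mean; [|X|] has a larger tail than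
    [X] on the half-line, and a finite mean. *)
Lemma integrable_ccdf (X : {RV P >-> R}) (p : R) : 1 < p ->
  ('E_P[(fun w => `|X w| `^ p)%R] < +oo)%E ->
  (\int[mu]_(x in D) ccdf X x < +oo)%E.
Proof.
move=> p1 Xp.
have mX : measurable_fun setT (fun w => `|X w|) by exact: measurableT_comp.
pose Y : {RV P >-> R} := mfun_Sub (mem_set mX).
have Y0 w : 0 <= Y w by rewrite /Y /=.
have : ('E_P[Y] < +oo)%E.
  rewrite expectation_def; apply: le_lt_trans (_ : \int[P]_w (1 + (`|X w| `^ p)%:E) < +oo)%E.
    apply: ge0_le_integral => //.
    - by move=> w _; rewrite lee_fin.
    - by apply/measurable_EFinP.
    - apply: emeasurable_funD => //; apply/measurable_EFinP.
      exact: (measurableT_comp (@measurable_powR R p) mX).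
    - move=> w _; rewrite -EFinD lee_fin /Y/=.
      have [x1|x1] := leP `|X w| 1; first by rewrite ler_wpDr ?powR_ge0.
      by rewrite ler_wpDl// le1r_powR// ltW.
  rewrite ge0_integralD//; last first.
    apply/measurable_EFinP; exact: (measurableT_comp (@measurable_powR R p) mX).
  rewrite lte_add_pinfty//; first by rewrite (integral_cstP P 1) ltry.
  by move: Xp; rewrite unlock.
apply: le_lt_trans; rewrite ge0_expectation_ccdf//.
apply: ge0_le_integral => //.
- by apply: measurable_funTS; exact: ccdf_measurable.
- by apply: measurable_funTS; exact: ccdf_measurable.
move=> x _; rewrite /ccdf /distribution /pushforward; apply: le_measure; rewrite ?inE//.
- by rewrite -[X in measurable X]setTI; exact: measurable_funPT.
- by rewrite -[X in measurable X]setTI; exact: measurable_funPT.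
move=> w /=; rewrite !in_itv/= !andbT /Y/= => xX.
exact: lt_le_trans xX (ler_norm _).
Qed.

End almost_sure.

Theorem theorem4p1 (R : realType) (d : measure_display) (T : measurableType d)
  (P : probability T R) (alpha p : R) (X : {RV P >-> R})
  (Xs : nat -> {RV P >-> R})
  (alpha01 : 0 < alpha < 1)
  (X_ge0 : {ae P, forall w, 0 <= X w})
  (X_ac : distribution P X `<< (@lebesgue_measure R))
  (p_gt1 : 1 < p)
  (X_moment : ('E_P[(fun w => `|X w| `^ p)%R] < +oo)%E)
  (Xs_sample : random_sample_from (cdf X) Xs) :
  {ae P, forall w,
    efcpe alpha (empirical_cdf (mkseq (fun i => Xs i w) n)) @[n --> \oo]
      --> efcpe alpha (fun x => fine (cdf X x))}.
Proof.
case: Xs_sample => indep Xs_cdf; case/andP: (alpha01) => a0 a1.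
pose F x : R := fine (cdf X x).
have FE x : (F x)%:E = cdf X x by rewrite fineK// fin_num_measure.
have cdfE i x : P (Xs i @^-1` `]-oo, x]) = (F x)%:E by rewrite FE -(Xs_cdf i).
have mF : measurable_fun setT F.
  by apply: measurableT_comp; [exact: fine_measurable|exact: cdf_measurable].
have F01 x := F01 cdfE x.
pose mu := @lebesgue_measure R; pose D : set R := `[0%R, +oo[%classic.
have mD : measurable D by exact: measurable_itv.
have onemF0 x : 0 <= 1 - F x by exact: onemF_ge0 cdfE x.
have monemF : measurable_fun setT (fun x => 1 - F x) by exact: measurable_funB.
have onemF_lty : (\int[mu]_(x in D) (1 - F x)%:E < +oo)%E.
  apply: le_lt_trans (integrable_ccdf p_gt1 X_moment).
  by under eq_integral do rewrite EFinB FE -ccdf_1_cdf.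
(* a point beyond a median, where the half-line is split *)
have [x0 x0_ge0 Fx0] : exists2 x0, 0 <= x0 & 2^-1 <= F x0.
  have : F x @[x --> +oo] --> (1 : R).
    by apply/fine_cvg; exact: cvg_cdfy1.
  have half1 : 2^-1 < 1 :> R by rewrite invf_lt1// ltr1n.
  move=> /cvgr_ge/(_ _ half1) H.
  have : \forall x \near +oo, 0 <= x /\ 2^-1 <= F x.
    by near=> x; split; near: x => //; exact: nbhs_pinfty_ge.
  by move=> /(pinfty_ex_ge (num_real 0)) [x _ [? ?]]; exists x.
have g0 : 0 < alpha^-1 - 1 by rewrite subr_gt0 invf_gt1.
have r1 : 1 < Num.min alpha^-1 2 by rewrite lt_min invf_gt1// a1 ltr1n.
have dev_ae : {ae P, forall w, (\int[mu]_(x in D) dev_majorant Xs F (x, w) < +oo)%E}.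
  apply: (ae_path_integral_lty mD (dev_majorant_measurable Xs mF)
    (dev_majorant_ge0 Xs F) monemF onemF0 (ltr0n R 2)) onemF_lty.
  exact: dev_majorant_expectation indep cdfE mF.
have null_ae : {ae P, forall w, (\int[mu]_(x in D) null_majorant Xs F (x, w) < +oo)%E}.
  apply: (ae_path_integral_lty mD (null_majorant_measurable Xs mF)
    (null_majorant_ge0 Xs F) monemF onemF0 (ltr0n R 1)) onemF_lty.
  by move=> x; rewrite null_majorant_expectation// lee_fin mul1r.
have tail_ae : {ae P, forall w,
    (\int[mu]_(x in D) tail_majorant Xs F (Num.min alpha^-1 2)%R (x, w) < +oo)%E}.
  have [C C0 HC] := tail_majorant_expectation indep cdfE mF r1.
  exact: (ae_path_integral_lty mD (tail_majorant_measurable Xs mF _)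
    (tail_majorant_ge0 cdfE _) monemF onemF0 C0 HC onemF_lty).
have dev0_ae : {ae P, forall w, (dev_majorant Xs F (x0, w) < +oo)%E}.
  have := @ge0_ae_lty _ _ _ P setT (fun w => dev_majorant Xs F (x0, w)) measurableT
    (measurable_slice x0 (dev_majorant_measurable Xs mF))
    (fun w _ => dev_majorant_ge0 Xs F (x0, w))
    (le_lt_trans (dev_majorant_expectation indep cdfE mF x0) (ltry _)).
  by apply: filterS => w /(_ Logic.I).
have inv_ae : {ae P, forall w,
    (\int[mu]_(x in `[0%R, x0]) (F x `^ (- (alpha^-1 - 1)))%:E < +oo)%E ->
    (\int[mu]_(x in `[0%R, x0]) inv_majorant Xs F (alpha^-1 - 1)%R (x, w) < +oo)%E}.
  have [Fy|Fy] := ltP (\int[mu]_(x in `[0%R, x0]) (F x `^ (- (alpha^-1 - 1)))%:E)%E +oo%E.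
    have [C C0 HC] := inv_majorant_expectation indep cdfE mF g0.
    have := ae_path_integral_lty (measurable_itv _) (inv_majorant_measurable Xs mF _)
      (inv_majorant_ge0 Xs F _) (measurableT_comp (@measurable_powR R _) mF)
      (fun x => powR_ge0 _ _) C0 HC Fy.
    by apply: filterS.
  by apply: aeW => w.
have aeP : Filter (nbhs (almost_everywhere P)) by exact: ae_filter_ringOfSetsType.
have both A B := @filterI _ _ aeP A B.
have ev := both _ _ (both _ _ dev_ae null_ae)
  (both _ _ tail_ae (both _ _ dev0_ae inv_ae)).
apply: (@filterS _ _ aeP _ _ _ ev) => w [[h1 h2] [h3 [h4 h5]]].
exact: (efcpe_path_cvg mF cdfE alpha01 Fx0 h1 h2 h3 h4 h5).
Unshelve. all: by end_near.
Qed.
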